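(* Every non-convex pentagon in the plane is of exactly one of the following two types: (1) it has exactly one interior angle larger than $\pi$ (Type 1); (2) it has exactly two interior angles larger than $\pi$ (these can be adjacent or non-adjacent), and the average of these two angles is less than $3\pi/2$ (Type 2). Moreover, a unit-area Type 1 pentagon has perimeter greater than that of a unit-area square, namely $4$, and a unit-area Type 2 pentagon has perimeter greater than that of a unit-area equilateral triangle, namely $3\sqrt{4/\sqrt3}\approx 4.559$.
   Context: Pentagons are simple polygons with five sides. *)

(* Defs.v *)
From HB Require Import structures.
From mathcomp Require Import all_boot all_order all_algebra.
From mathcomp Require Import all_classical all_reals all_analysis.
Import Order.TTheory GRing.Theory Num.Theory.
Import numFieldNormedType.Exports.

Set Implicit Arguments.
Unset Strict Implicit.
Unset Printing Implicit Defensive.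

Local Open Scope classical_set_scope.
Local Open Scope ring_scope.

(* The library's norm on R * R is the sup norm; lengths and angles below use
   the Euclidean one. *)
Definition dot (R : realType) (u v : R * R) : R := u.1 * v.1 + u.2 * v.2.

Definition elen (R : realType) (u : R * R) : R := Num.sqrt (dot u u).

(* Unoriented angle, in [0, pi], between nonzero vectors. *)
Definition angle (R : realType) (u v : R * R) : R :=
  acos (dot u v / (elen u * elen v)).

(* A polygon is given by its n vertices in cyclic order (in either of the two
   orientations); side i goes from p i to p (ordS i), indices being taken
   modulo n. *)
Definition side_pt (R : realType) (n : nat) (p : 'I_n -> R * R) (i : 'I_n)
    (t : R) : R * R :=
  p i + t *: (p (ordS i) - p i).

(* The closed polygonal line has no self-intersection: each of its points is
   met once, the end of a side being counted as the start of the next one.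
   Collinear consecutive sides are not excluded. *)
Definition simple_polygon (R : realType) (n : nat) (p : 'I_n -> R * R) : Prop :=
  forall (i j : 'I_n) (s t : R), 0 <= s < 1 -> 0 <= t < 1 ->
    side_pt p i s = side_pt p j t -> i = j /\ s = t.

Definition pentagon (R : realType) (p : 'I_5 -> R * R) : Prop :=
  simple_polygon p.

Definition boundary (R : realType) (n : nat) (p : 'I_n -> R * R) :
    set (R * R) :=
  [set x | exists i : 'I_n, exists2 t : R, 0 <= t <= 1 & x = side_pt p i t].

(* Points of the bounded component of the complement of the boundary. *)
Definition inside (R : realType) (n : nat) (p : 'I_n -> R * R) :
    set (R * R) :=
  [set x | ~ boundary p x /\
           bounded_set (connected_component (~` boundary p) x)].

Definition region (R : realType) (n : nat) (p : 'I_n -> R * R) :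
    set (R * R) :=
  boundary p `|` inside p.

Definition perimeter (R : realType) (n : nat) (p : 'I_n -> R * R) : R :=
  \sum_(i < n) elen (p (ordS i) - p i).

Definition area (R : realType) (n : nat) (p : 'I_n -> R * R) : \bar R :=
  (lebesgue_measure \x lebesgue_measure)%E (region p).

Definition convex_polygon (R : realType) (n : nat) (p : 'I_n -> R * R) : Prop :=
  convex_set (region p).

(* Near the vertex p i, the open convex sector between the two sides meeting
   there lies inside the polygon. *)
Definition sector_inside (R : realType) (n : nat) (p : 'I_n -> R * R)
    (i : 'I_n) : Prop :=
  exists2 e : R, 0 < e &
    forall s t : R, 0 < s < e -> 0 < t < e ->
      inside p (p i + s *: (p (ordS i) - p i) + t *: (p (ord_pred i) - p i)).

(* The two sides meeting at p i bound two sectors, of angles a <= pi and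
   2 * pi - a; the interior angle is that of the sector on the inner side.
   If the two sides are aligned, both expressions are pi. *)
Definition interior_angle (R : realType) (n : nat) (p : 'I_n -> R * R)
    (i : 'I_n) : R :=
  let a := angle (p (ordS i) - p i) (p (ord_pred i) - p i) in
  if `[< sector_inside p i >] then a else 2 * pi - a.

Definition reflex (R : realType) (n : nat) (p : 'I_n -> R * R) : {set 'I_n} :=
  [set i | pi < interior_angle p i]%SET.

Definition type1 (R : realType) (p : 'I_5 -> R * R) : Prop :=
  #|reflex p| = 1%N.

Definition type2 (R : realType) (p : 'I_5 -> R * R) : Prop :=
  #|reflex p| = 2%N /\
  (\sum_(i in reflex p) interior_angle p i) / 2 < 3 * pi / 2.

Definition adjacent_vertices (n : nat) (i j : 'I_n) : Prop :=
  j = ordS i \/ i = ordS j.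

(* Main.v *)
Require Import Defs.
From mathcomp Require Import all_boot all_order all_algebra.
From mathcomp Require Import all_classical all_reals all_analysis.
From mathcomp Require Import measurable_realfun zify ring lra.
Import Order.TTheory GRing.Theory Num.Theory.
Import numFieldNormedType.Exports.
Set Implicit Arguments.
Unset Strict Implicit.
Unset Printing Implicit Defensive.
Local Open Scope classical_set_scope.
Local Open Scope ring_scope.

(* HEADER *)

(** The topological core is a weak form of the Jordan curve theorem ([oriented_exists]): for some
    sign [s], all points close to the flank of sign [s] of any side are inside, and those close to
    the opposite flank are not. Sliding along the sides and past the corners shows that equal flanks
    of all sides lie in one component of the complement ([beside_all]). The even-odd crossing number
    is constant on components, is even far away, and changes across a side, so one flank is inside;
    at a strictly extreme vertex a ray escapes to infinity, so one flank is outside. From then on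
    being reflex is the sign of a cross product ([reflexP]).

    The geometric core is that every linear functional is maximal over the vertices at a nonreflex
    one ([nonreflex_max]), because a strictly extreme vertex turns the convex way. Hence the region
    lies in the convex hull of the nonreflex vertices, and these are not collinear
    ([nonreflex_noncollinear]). At least three vertices of a pentagon are therefore nonreflex, which
    leaves at most two reflex ones ([reflex_card_le2]). With none, all turns have the same sign, and
    a vertex on the wrong side of a side would force a pentagram, so the pentagon is convex
    ([no_reflex_convex]).

    With two reflex vertices, both lie in the triangle of the other three. The bound on the average
    says that the two angles complementary to [2 * pi] add up to more than [pi], that is, that the
    sine of their sum is negative; this becomes a polynomial inequality in signed areas and dot
    products ([adjacent_angles], [nonadjacent_angles]).

    For the perimeters, skipping the reflex vertices strictly shortens the closed line and keeps all
    the nonreflex vertices, whose hull has area at least 1. For Type 1 a closed line of length [L]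
    through four points remains, and their hull has area at most [L ^+ 2 / 16] in whatever order the
    hull visits them ([four_points_hull_area]). For Type 2 a triangle remains, and Heron's formula
    with the arithmetic-geometric mean inequality concludes ([triangle_perimeter_ge]). Two explicit
    pentagons show that the reflex vertices of Type 2 can be adjacent or not. *)

Section Plane.
Variable R : realType.
Implicit Types (u v w x y d : R * R) (s t : R).

(** * Vector algebra in the plane *)

Definition cross u v : R := u.1 * v.2 - u.2 * v.1.

Definition perp u : R * R := (- u.2, u.1).

Definition orient x y z : R := cross (y - x) (z - x).

Lemma fst_add u v : (u + v).1 = u.1 + v.1. Proof. by []. Qed.
Lemma snd_add u v : (u + v).2 = u.2 + v.2. Proof. by []. Qed.
Lemma fst_opp u : (- u).1 = - u.1. Proof. by []. Qed.
Lemma snd_opp u : (- u).2 = - u.2. Proof. by []. Qed.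
Lemma fst_scale t u : (t *: u).1 = t * u.1. Proof. by []. Qed.
Lemma snd_scale t u : (t *: u).2 = t * u.2. Proof. by []. Qed.
Definition coordE := (fst_add, snd_add, fst_opp, snd_opp, fst_scale, snd_scale).

Lemma vec_eq u v : u.1 = v.1 -> u.2 = v.2 -> u = v.
Proof. by case: u v => a b [c d] /= -> ->. Qed.

Lemma dot_gt0 u : (0 < dot u u) = (u != 0).
Proof.
rewrite /dot lt_neqAle addr_ge0 ?andbT -?expr2 ?sqr_ge0 //.
rewrite eq_sym paddr_eq0 ?sqr_ge0 // !sqrf_eq0; case: u => a b /=.
by rewrite [in RHS]/eq_op.
Qed.

Lemma dot_ge0 u : 0 <= dot u u.
Proof. by rewrite /dot addr_ge0 // -expr2 sqr_ge0. Qed.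

Lemma cross0_colinear u v : u != 0 -> cross u v = 0 ->
  v = (dot u v / dot u u) *: u.
Proof.
rewrite -dot_gt0 => u0 uv; apply: vec_eq; rewrite !coordE;
  apply: (mulIf (lt0r_neq0 u0)).
- rewrite mulrAC divfK ?gt_eqF //; apply/eqP; rewrite -subr_eq0.
  by apply/eqP; transitivity (- u.2 * cross u v); [rewrite /cross /dot; ring | rewrite uv mulr0].
- rewrite mulrAC divfK ?gt_eqF //; apply/eqP; rewrite -subr_eq0.
  by apply/eqP; transitivity (u.1 * cross u v); [rewrite /cross /dot; ring | rewrite uv mulr0].
Qed.

End Plane.

(** * Continuity of affine maps, and segments inside components *)

Section Topology.
Variable R : realType.
Implicit Types (x y z d : R * R) (A : set (R * R)).

Lemma dot_continuous d : continuous (dot d).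
Proof.
move=> x; apply: cvgD; (apply: cvgM; first exact: cvg_cst).
  exact: cvg_fst.
exact: cvg_snd.
Qed.

Lemma near_gt0 (f : R * R -> R) x :
  {for x, continuous f} -> 0 < f x -> \forall y \near x, 0 < f y.
Proof. by move=> cf fx; exact: (@cvgr_gt _ _ _ _ f (f x) cf 0 fx). Qed.

Lemma line_continuous (f : R -> R) x d :
  continuous f -> continuous (fun t : R => x + f t *: d).
Proof.
move=> cf t; apply: cvgD; first exact: cvg_cst.
by apply: cvgZr_tmp => //; exact: cf.
Qed.

Lemma segment_sub_component A x y :
  (forall t, 0 <= t <= 1 -> A (x + t *: (y - x))) -> connected_component A x y.
Proof.
move=> Axy; pose f t := x + t *: (y - x).
have cf : {within `[0, 1], continuous f}.
  apply: continuous_subspaceT; apply: (@line_continuous id).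
  by move=> ?; exact: cvg_id.
have f0 : (f @` `[0, 1]) x.
  by exists 0; rewrite /f ?scale0r ?addr0 //= in_itv /= lexx ler01.
have f1 : (f @` `[0, 1]) y.
  by exists 1; rewrite /f ?scale1r ?subrKC //= in_itv /= lexx ler01.
have := connected_component_max f0 _ (connected_continuous_connected (@segment_connected R 0 1) cf).
apply=> // _ [t /= t01 <-]; apply: Axy; by rewrite in_itv /= in t01.
Qed.

End Topology.

(** * Sides of a simple polygon and how they meet *)

Section Sides.
Variables (R : realType) (n : nat) (p : 'I_n -> R * R).
Implicit Types (i j : 'I_n) (s t : R) (x y z b d : R * R).

Definition edge i : R * R := p (ordS i) - p i.

Lemma side_pt0 i : side_pt p i 0 = p i.
Proof. by rewrite /side_pt scale0r addr0. Qed.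

Lemma side_pt1 i : side_pt p i 1 = p (ordS i).
Proof. by rewrite /side_pt scale1r subrKC. Qed.

Lemma side_ptE i t : side_pt p i t = p (ordS i) - (1 - t) *: edge i.
Proof. by rewrite /side_pt /edge; apply: vec_eq; rewrite !coordE; ring. Qed.

Lemma side_pt_continuous i : continuous (side_pt p i).
Proof. by apply: (@line_continuous _ id) => t; exact: cvg_id. Qed.

Lemma side_compact i : compact [set side_pt p i t | t in `[0, 1]].
Proof.
apply: continuous_compact; last exact: segment_compact.
by apply: continuous_subspaceT; exact: side_pt_continuous.
Qed.

Lemma boundary_closed : closed (boundary p).
Proof.
rewrite -openC openE => x nx.
have : \forall y \near x, forall i, ~ [set side_pt p i t | t in `[0, 1]] y.
  apply: (filter_forall (nbhs_filter x)) => i.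
  have := closed_openC (compact_closed (@norm_hausdorff _ _) (@side_compact i)).
  rewrite openE => /(_ x) op; apply: op => -[t /= t01 tx].
  by apply: nx; exists i, t => //; rewrite in_itv /= in t01.
by apply: filterS => y ny [i [t t01 ty]]; apply: (ny i); exists t; rewrite //= in_itv.
Qed.

Lemma near_off_boundary x : ~ boundary p x -> \forall y \near x, ~ boundary p y.
Proof.
by move=> nx; have := closed_openC boundary_closed; rewrite openE => /(_ x nx).
Qed.

(** The differences between points of two disjoint compact pieces of sides form a closed set that
    avoids 0, hence avoids [e *: b] for small [e]. *)
Lemma near_translate_disjoint i j (a1 a2 c1 c2 : R) b :
  (forall s t, a1 <= s <= a2 -> c1 <= t <= c2 -> side_pt p i s <> side_pt p j t) ->
  \forall e \near (0 : R)^'+, forall s t, a1 <= s <= a2 -> c1 <= t <= c2 ->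
    side_pt p i s + e *: b <> side_pt p j t.
Proof.
move=> dis; pose g (st : R * R) := side_pt p j st.2 - side_pt p i st.1.
pose K := g @` (`[a1, a2] `*` `[c1, c2]).
have cK : closed K.
  apply: compact_closed; first exact: norm_hausdorff.
  rewrite /K; apply: continuous_compact; last first.
    by apply: compact_setX; apply: segment_compact.
  apply: continuous_subspaceT => st; apply: cvgB.
    by apply: continuous_comp; [exact: cvg_snd | exact: side_pt_continuous].
  by apply: continuous_comp; [exact: cvg_fst | exact: side_pt_continuous].
have K0 : (~` K) 0.
  move=> [[s t] /= [/= s1 t1]] /eqP; rewrite subr_eq0 => /eqP e.
  by apply: (dis s t).
have nK : \forall x \near (0 : R * R), (~` K) x.
  by have := closed_openC cK; rewrite openE => /(_ 0 K0).
have cvb : (e *: b @[e --> (0 : R)^'+]) --> (0 : R * R).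
  rewrite -[X in _ --> X](scale0r b); apply: cvgZr_tmp.
  exact: cvg_at_right_filter.
have nKe : \forall e \near (0 : R)^'+, (~` K) (e *: b) by exact: (cvb _ nK).
move: nKe; apply: filterS => e nKe s t hs ht est.
apply: nKe; exists (s, t) => /=; first by split; rewrite /= in_itv.
by rewrite /g /= -est addrAC subrr add0r.
Qed.

Hypothesis hp : simple_polygon p.

Lemma vertex_inj : injective p.
Proof.
move=> i j pij; have := @hp i j 0 0; rewrite !side_pt0 lexx ltr01.
by case.
Qed.

Lemma edge_neq0 i : edge i != 0.
Proof.
apply/eqP => e0; have := @hp i i 0 (1 / 2); rewrite /side_pt -/(edge i) e0 !scaler0.
by case=> //; lra.
Qed.

Lemma ordS_neq i : ordS i != i.
Proof.
by apply/eqP => e; have := edge_neq0 i; rewrite /edge e subrr eqxx.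
Qed.

(** Simplicity speaks of half-open sides; writing an upper end as the start of the next side extends
    it to closed sides, at the price of shared vertices. *)
Lemma sides_meet i j s t : 0 <= s <= 1 -> 0 <= t <= 1 ->
  side_pt p i s = side_pt p j t ->
  [\/ i = j /\ s = t, [/\ j = ordS i, s = 1 & t = 0] |
      [/\ i = ordS j, s = 0 & t = 1]].
Proof.
move=> s01 t01.
have [s1|s1] := eqVneq s 1; have [t1|t1] := eqVneq t 1.
- rewrite s1 t1 !side_pt1 => /vertex_inj /(can_inj (@ordSK n)) ->.
  by constructor 1.
- rewrite s1 side_pt1 -[p (ordS i)]side_pt0 => e.
  case: (hp _ _ e) => [||-> <-]; [by lra | by lra |].
  by constructor 2.
- rewrite t1 side_pt1 -[p (ordS j)]side_pt0 => e.
  case: (hp _ _ e) => [||-> <-]; [by lra | by lra |].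
  by constructor 3.
- move=> e; case: (hp _ _ e) => [||-> <-]; [by lra | by lra |].
  by constructor 1.
Qed.

(* Sides folding back at a vertex would overlap. *)
Lemma aligned_edges i : cross (edge i) (edge (ordS i)) = 0 ->
  exists2 k : R, 0 < k & edge (ordS i) = k *: edge i.
Proof.
move=> /(cross0_colinear (edge_neq0 i)); set k := _ / _ => e.
exists k => //; rewrite ltNge; apply/negP => k0.
have {k0} k0 : k < 0.
  rewrite lt_neqAle k0 andbT; apply/eqP => kz.
  by have := edge_neq0 (ordS i); rewrite e kz scale0r eqxx.
(* The next side runs back over side [i]: its point of parameter [t] is the point of parameter
   [1 + t * k] of side [i], and this choice of [t] keeps both parameters in the half-open
   interval. *)
have [t t0 [t1 t2]] : exists2 t : R, 0 < t & t * (1 - k) = 1 / 2 /\ t * k < 0.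
  have k1 : 0 < 1 - k by rewrite subr_gt0 (lt_trans k0).
  have t0 : 0 < (1 - k)^-1 / 2 by rewrite divr_gt0 // invr_gt0.
  exists ((1 - k)^-1 / 2) => //; split; last by rewrite pmulr_rlt0.
  by rewrite mulrAC mulVf ?gt_eqF.
have := @hp i (ordS i) (1 + t * k) t; case.
- by clear e; lra.
- by clear e; lra.
- by rewrite side_ptE /side_pt -/(edge _) e; apply: vec_eq; rewrite !coordE; ring.
- by move=> /esym /eqP; rewrite (negbTE (ordS_neq i)).
Qed.

End Sides.

(** * The two flanks of the boundary, each in one component *)

Section Reach.
Variables (R : realType) (n : nat) (p : 'I_n -> R * R).
Implicit Types (i j : 'I_n) (s t : R) (x y z b d : R * R).

Definition reach x y := connected_component (~` boundary p) x y.

Lemma reach_sym x y : reach x y -> reach y x.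
Proof. exact: connected_component_sym. Qed.

Lemma reach_trans y x z : reach x y -> reach y z -> reach x z.
Proof. exact: connected_component_trans. Qed.

Lemma reach_off x y : reach x y -> ~ boundary p y.
Proof. exact: connected_component_sub. Qed.

Lemma segment_reach x y :
  (forall t, 0 <= t <= 1 -> ~ boundary p (x + t *: (y - x))) -> reach x y.
Proof. exact: segment_sub_component. Qed.

Lemma reach_inside x y : reach x y -> inside p x -> inside p y.
Proof.
move=> xy [_ bx]; split; first exact: reach_off xy.
by rewrite -(same_connected_component xy).
Qed.

Lemma convex_gt0 (t a b : R) : 0 <= t <= 1 -> 0 < a -> 0 < b ->
  0 < (1 - t) * a + t * b.
Proof.
move=> /andP[t0 t1] a0 b0; have [->|tn0] := eqVneq t 0.
  by rewrite subr0 mul1r mul0r addr0.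
apply: ltr_wpDl; first by rewrite mulr_ge0 ?subr_ge0 // ltW.
by rewrite mulr_gt0 // lt_neqAle eq_sym tn0.
Qed.

Lemma ball_segment (m x y : R * R) (r t : R) : 0 <= t <= 1 ->
  ball m r x -> ball m r y -> ball m r (x + t *: (y - x)).
Proof.
move=> t01 [x1 x2] [y1 y2].
have conv (a b c : R) : ball c r a -> ball c r b -> ball c r (a + t * (b - a)).
  rewrite -ball_normE /ball_ /= !ltr_norml.
  move=> /andP[a1 a2] /andP[b1 b2]; apply/andP; split; rewrite -subr_gt0.
    have -> : c - (a + t * (b - a)) - - r = (1 - t) * (c - a - - r) + t * (c - b - - r) by ring.
    by apply: convex_gt0; rewrite ?subr_gt0.
  have -> : r - (c - (a + t * (b - a))) = (1 - t) * (r - (c - a)) + t * (r - (c - b)) by ring.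
  by apply: convex_gt0; rewrite ?subr_gt0.
by split; apply: conv.
Qed.

Lemma near_off_sides (P : pred 'I_n) x :
  (forall j t, P j -> 0 <= t <= 1 -> side_pt p j t <> x) ->
  \forall y \near x, forall j t, P j -> 0 <= t <= 1 -> side_pt p j t <> y.
Proof.
move=> off.
have : \forall y \near x, forall j, P j ->
    ~ [set side_pt p j t | t in `[0, 1]] y.
  apply: (filter_forall (nbhs_filter x)) => j.
  have [Pj|nPj] := boolP (P j); last by apply: nearW.
  have := closed_openC (compact_closed (@norm_hausdorff _ _) (@side_compact _ _ p j)).
  rewrite openE => /(_ x) op; near=> y => _; near: y; apply: op => -[t /= t01 tx].
  by apply: (off j t) => //; rewrite in_itv /= in t01.
apply: filterS => y ny j t Pj t01 e; apply: (ny j Pj).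
by exists t; rewrite //= in_itv.
Unshelve. all: by end_near. Qed.

Lemma near_ray x b : x + e *: b @[e --> (0 : R)^'+] --> x.
Proof.
rewrite -[X in _ --> X]addr0 -[X in _ + X](scale0r b).
apply: cvgD; first exact: cvg_cst.
by apply: cvgZr_tmp; apply: cvg_at_right_filter; exact: cvg_id.
Qed.

Definition mid i : R * R := side_pt p i (1 / 2).

Lemma side_pt_mid i t : side_pt p i t - mid i = (t - 1 / 2) *: edge p i.
Proof. by rewrite /mid /side_pt /edge; apply: vec_eq; rewrite !coordE; ring. Qed.

(* For s > 0 (resp. s < 0), the points reachable from the left (resp. right)
   of the middle of side i. *)
Definition beside (s : R) i x : Prop :=
  \forall e \near (0 : R)^'+, reach (mid i + e *: (s *: perp (edge p i))) x.

Lemma beside_reach s i x y : beside s i x -> reach x y -> beside s i y.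
Proof. by move=> sx xy; apply: filterS sx => e /reach_trans; exact. Qed.

Lemma reach_beside s i x y : beside s i x -> beside s i y -> reach x y.
Proof.
move=> sx sy; have [e [ex ey]] := filter_ex (filterI sx sy).
by apply: reach_trans ey; apply: reach_sym.
Qed.

Lemma beside_off s i x : beside s i x -> ~ boundary p x.
Proof. by move=> sx; have [e /reach_off] := filter_ex sx. Qed.

Hypothesis hp : simple_polygon p.

(** A small ball around the middle of side [i] meets no other side, and each of its two open halves
    is convex, so segments in a half avoid the boundary. *)
Lemma beside_half_disc s i : exists2 r : R, 0 < r & forall x y,
  ball (mid i) r x -> ball (mid i) r y ->
  0 < s * cross (edge p i) (x - mid i) -> 0 < s * cross (edge p i) (y - mid i) ->
  reach x y.
Proof.
have off : \forall x \near mid i, forall j t, predC1 i j -> 0 <= t <= 1 ->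
    side_pt p j t <> x.
  apply: near_off_sides => j t /= /eqP ji t01 e.
  case: (sides_meet hp t01 _ e) => [|[]|[]|[]] //; by lra.
move/nbhs_ballP : off => [r /= r0 off]; exists r => // x y xr yr sx sy.
apply: segment_reach => t t01 [j [c c01 e]].
have [ji|ji] := eqVneq j i; last first.
  by apply: (off _ (ball_segment t01 xr yr) j c) => //; rewrite e.
have : s * cross (edge p i) (x + t *: (y - x) - mid i) = 0.
  by rewrite e ji side_pt_mid /cross !coordE; ring.
have -> : s * cross (edge p i) (x + t *: (y - x) - mid i) =
   (1 - t) * (s * cross (edge p i) (x - mid i)) + t * (s * cross (edge p i) (y - mid i)).
  by rewrite /cross !coordE; ring.
by apply/eqP; rewrite gt_eqF // convex_gt0.
Qed.

Lemma beside_near_mid s i b : 0 < s * cross (edge p i) b ->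
  \forall e \near (0 : R)^'+, beside s i (mid i + e *: b).
Proof.
move=> sb; have [r r0 h] := beside_half_disc s i.
have inr d : \forall e \near (0 : R)^'+, ball (mid i) r (mid i + e *: d).
  exact: (@near_ray (mid i) d _ (nbhsx_ballx (mid i) r r0)).
have pos d e : 0 < s * cross (edge p i) d -> 0 < e ->
    0 < s * cross (edge p i) (mid i + e *: d - mid i).
  move=> sd e0; have -> : s * cross (edge p i) (mid i + e *: d - mid i) =
    e * (s * cross (edge p i) d) by rewrite /cross !coordE; ring.
  by rewrite mulr_gt0.
have s0 : 0 < s * cross (edge p i) (s *: perp (edge p i)).
  have -> : s * cross (edge p i) (s *: perp (edge p i)) = s ^+ 2 * dot (edge p i) (edge p i).
    by rewrite /cross /perp /dot !coordE /=; ring.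
  rewrite mulr_gt0 ?dot_gt0 ?edge_neq0 // exprn_even_gt0 //.
  by apply/eqP => s0; move: sb; rewrite s0 mul0r ltxx.
near=> e; near=> e'; apply: h.
- by near: e'; apply: inr.
- by near: e; apply: inr.
- by apply: pos.
- by apply: pos.
Unshelve. all: by end_near. Qed.

(** The two half sides at a corner are pushed along a direction that points to the same flank of
    both. Far sides stay away by compactness, a side is parallel to its own translate, and the two
    sides at the corner are treated by [cone]. *)
Lemma corner_path s i b : 0 < s * cross (edge p i) b ->
    0 < s * cross (edge p (ordS i)) b ->
  \forall e \near (0 : R)^'+,
    (forall t, 1 / 2 <= t <= 1 -> ~ boundary p (side_pt p i t + e *: b)) /\
    (forall t, 0 <= t <= 1 / 2 -> ~ boundary p (side_pt p (ordS i) t + e *: b)).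
Proof.
move=> sb sb'.
pose c := s * cross (edge p i) (edge p (ordS i)).
(* A translated half side meeting one of the two sides at the corner would
   give [e b = a u + a' w] with [a] and [a'] of the same sign, where [u] and
   [w] are the two edges; crossing with [u] and [w] yields [a' c > 0 > a c]. *)
have cone e a a' : 0 < e -> 0 <= a * a' ->
    e *: b = a *: edge p i + a' *: edge p (ordS i) -> False.
  move=> e0 aa' eb.
  have e1 : e * (s * cross (edge p i) b) = a' * c.
    transitivity (s * cross (edge p i) (e *: b)); first by rewrite /cross !coordE; ring.
    by rewrite eb /c /cross !coordE; ring.
  have e2 : e * (s * cross (edge p (ordS i)) b) = - (a * c).
    transitivity (s * cross (edge p (ordS i)) (e *: b)); first by rewrite /cross !coordE; ring.
    by rewrite eb /c /cross !coordE; ring.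
  have p1 : 0 < a' * c by rewrite -e1 mulr_gt0.
  have p2 : 0 < - (a * c) by rewrite -e2 mulr_gt0.
  have : 0 < (a' * c) * (- (a * c)) by rewrite mulr_gt0.
  have -> : a' * c * - (a * c) = - (a * a' * c ^+ 2) by ring.
  by rewrite oppr_gt0 ltNge mulr_ge0 ?sqr_ge0.
have own e j t a : 0 < e -> 0 < s * cross (edge p j) b ->
    side_pt p j t + e *: b = side_pt p j a -> False.
  move=> e0 sj ej; have : 0 < e * (s * cross (edge p j) b) by rewrite mulr_gt0.
  suff -> : e * (s * cross (edge p j) b) = 0 by rewrite ltxx.
  transitivity (s * cross (edge p j) (side_pt p j t + e *: b - side_pt p j t)).
    by rewrite /cross !coordE; ring.
  by rewrite ej /cross /side_pt -/(edge p j) !coordE; ring.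
have n1 : \forall e \near (0 : R)^'+, forall j, predC (pred2 i (ordS i)) j ->
    forall t c, 1 / 2 <= t <= 1 -> 0 <= c <= 1 ->
      side_pt p i t + e *: b <> side_pt p j c.
  apply: (filter_forall (at_right_proper_filter 0)) => j.
  have [jP|] := boolP (predC (pred2 i (ordS i)) j); last by move=> ?; apply: nearW.
  suff h : forall t c, 1 / 2 <= t <= 1 -> 0 <= c <= 1 -> side_pt p i t <> side_pt p j c.
    by move: (near_translate_disjoint b h); apply: filterS => e he _.
  move=> t c' t1 c1 e; move: jP => /=.
  case: (sides_meet hp _ c1 e) => [|[-> _]|[-> _ _]|[_ t0 _]]; rewrite ?eqxx ?orbT //.
    by clear -t1; lra.
  by clear -t1 t0; lra.
have n2 : \forall e \near (0 : R)^'+, forall j, predC (pred2 i (ordS i)) j ->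
    forall t c, 0 <= t <= 1 / 2 -> 0 <= c <= 1 ->
      side_pt p (ordS i) t + e *: b <> side_pt p j c.
  apply: (filter_forall (at_right_proper_filter 0)) => j.
  have [jP|] := boolP (predC (pred2 i (ordS i)) j); last by move=> ?; apply: nearW.
  suff h : forall t c, 0 <= t <= 1 / 2 -> 0 <= c <= 1 ->
      side_pt p (ordS i) t <> side_pt p j c.
    by move: (near_translate_disjoint b h); apply: filterS => e he _.
  move=> t c' t1 c1 e; move: jP => /=.
  case: (sides_meet hp _ c1 e) => [|[-> _]|[_ t0 _]|[/(can_inj (@ordSK n)) -> _ _]]; rewrite ?eqxx ?orbT //.
    by clear -t1; lra.
  by clear -t1 t0; lra.
near=> e.
have e0 : 0 < e by near: e; exact: nbhs_right_gt.
have m1 := near n1 e; have m2 := near n2 e.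
split=> t t12 [j [a a01 ej]]; have [jP|] := boolP (predC (pred2 i (ordS i)) j).
- by apply: (m1 _ j jP t a).
- move=> /negPn /orP [/eqP|/eqP] ji; subst j; first exact: (own _ _ _ _ e0 sb ej).
  apply: (cone e (1 - t) a e0); first by rewrite mulr_ge0; clear -t12 a01; lra.
  transitivity (side_pt p i t + e *: b - side_pt p i t); first by rewrite addrAC subrr add0r.
  by rewrite ej side_ptE /side_pt -!/(edge p _); apply: vec_eq; rewrite !coordE; ring.
- by apply: (m2 _ j jP t a).
- move=> /negPn /orP [/eqP|/eqP] ji; subst j; last exact: (own _ _ _ _ e0 sb' ej).
  apply: (cone e (a - 1) (- t) e0).
    by rewrite mulrN -mulNr mulr_ge0; clear -t12 a01; lra.
  transitivity (side_pt p (ordS i) t + e *: b - side_pt p (ordS i) t).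
    by rewrite addrAC subrr add0r.
  by rewrite ej side_ptE /side_pt -!/(edge p _); apply: vec_eq; rewrite !coordE; ring.
Unshelve. all: by end_near. Qed.

Lemma beside_corner s i b : 0 < s * cross (edge p i) b ->
    0 < s * cross (edge p (ordS i)) b ->
  \forall e \near (0 : R)^'+, beside s i (p (ordS i) + e *: b) /\
    beside s (ordS i) (p (ordS i) + e *: b).
Proof.
move=> sb sb'.
have h := corner_path sb sb'.
have h1 := beside_near_mid sb; have h2 := beside_near_mid sb'.
near=> e; have [//|m1 m2] := near h e.
have b1 : beside s i (mid i + e *: b) by near: e.
have b2 : beside s (ordS i) (mid (ordS i) + e *: b) by near: e.
split.
  apply: (beside_reach b1); apply: segment_reach => t t01.
  have -> : mid i + e *: b + t *: (p (ordS i) + e *: b - (mid i + e *: b)) =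
      side_pt p i (1 / 2 + t / 2) + e *: b.
    by rewrite /mid !side_ptE; apply: vec_eq; rewrite !coordE; field.
  by apply: m1; clear -t01; lra.
apply: (beside_reach b2); apply: segment_reach => t t01.
have -> : mid (ordS i) + e *: b + t *: (p (ordS i) + e *: b - (mid (ordS i) + e *: b)) =
    side_pt p (ordS i) (1 / 2 - t / 2) + e *: b.
  by rewrite /mid /side_pt; apply: vec_eq; rewrite !coordE; field.
by apply: m2; clear -t01; lra.
Unshelve. all: by end_near. Qed.

Lemma corner_direction s i : s != 0 -> exists b,
  0 < s * cross (edge p i) b /\ 0 < s * cross (edge p (ordS i)) b.
Proof.
move=> s0; set u := edge p i; set w := edge p (ordS i).
have s2 : 0 < s ^+ 2 by rewrite exprn_even_gt0.
have u0 : 0 < dot u u by rewrite dot_gt0 edge_neq0.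
have [c0|c0] := eqVneq (cross u w) 0.
  have [k k0 e] := aligned_edges hp c0.
  exists (s *: perp u); rewrite -/u -/w; split.
    have -> : s * cross u (s *: perp u) = s ^+ 2 * dot u u.
      by rewrite /cross /perp /dot !coordE /=; ring.
    by rewrite mulr_gt0.
  have -> : s * cross w (s *: perp u) = s ^+ 2 * (k * dot u u).
    by rewrite /w e -/u /cross /perp /dot !coordE /=; ring.
  by rewrite mulr_gt0 // mulr_gt0.
have c2 : 0 < s ^+ 2 * cross u w ^+ 2 by rewrite mulr_gt0 // exprn_even_gt0.
(* At the vertex, [w - u] points into the convex sector between the two sides; the factor reverses
   it when the wanted flank is the other one. *)
exists ((s * cross u w) *: (w - u)); split.
  suff -> : s * cross u ((s * cross u w) *: (w - u)) = s ^+ 2 * cross u w ^+ 2 by [].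
  by rewrite /cross !coordE; ring.
suff -> : s * cross w ((s * cross u w) *: (w - u)) = s ^+ 2 * cross u w ^+ 2 by [].
by rewrite /cross !coordE; ring.
Qed.

Lemma beside_ordS s i x : s != 0 -> beside s i x -> beside s (ordS i) x.
Proof.
move=> s0 sx; have [b [sb sb']] := corner_direction i s0.
have [e [e1 e2]] := filter_ex (beside_corner sb sb').
exact: beside_reach e2 (reach_beside e1 sx).
Qed.

Lemma ordS_ind (P : 'I_n -> Prop) i :
  P i -> (forall j, P j -> P (ordS j)) -> forall j, P j.
Proof.
move=> Pi PS j; have Pk k : P (iter k (@ordS n) i) by elim: k => //= k /PS.
suff [k <-] : exists k, iter k (@ordS n) i = j by [].
exists (j + n - i)%N; apply: ord_inj.
have -> k : iter k (@ordS n) i = ((i + k) %% n)%N :> nat.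
  elim: k => [|k IH] /=; first by rewrite addn0 modn_small.
  by rewrite IH -addn1 modnDml addn1 addnS.
by rewrite subnKC ?modnDr ?modn_small // ltnW // ltn_addl.
Qed.

(** Passing the corners one after the other leads around the whole polygon, so the flanks of the
    same sign belong to a single component. *)
Lemma beside_all s i j x : s != 0 -> beside s i x -> beside s j x.
Proof.
by move=> s0 sx; apply: (@ordS_ind (fun j => beside s j x) i) => // k; apply: beside_ordS.
Qed.

End Reach.

(** * Crossings of a side with a horizontal ray *)

Section Crossing.
Variable R : realType.
Implicit Types (a b x y : R * R).

(* The side from [a] to [b], without its upper end, meets the open horizontal
   ray going right from [x]. *)
Definition crosses a b x : bool :=
  if a.2 <= x.2 < b.2 then 0 < orient a b x
  else if b.2 <= x.2 < a.2 then orient a b x < 0 else false.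

Definition level a x y : bool := [&& a.2 == x.2, x.1 < a.1 & y.2 < a.2].

(* Each of the two sides at a vertex [a] on the ray changes its crossing status
   when the ray moves past [a]; the [level] terms record these changes, and
   they cancel out when summed around the polygon. *)
Lemma crosses_stable a b x y :
    (forall t, 0 <= t <= 1 -> a + t *: (b - a) <> x) ->
    (a.2 < x.2 -> a.2 < y.2) -> (x.2 < a.2 -> y.2 < a.2) ->
    (b.2 < x.2 -> b.2 < y.2) -> (x.2 < b.2 -> y.2 < b.2) ->
    (0 < orient a b x -> 0 < orient a b y) ->
    (orient a b x < 0 -> orient a b y < 0) ->
  crosses a b y (+) (level a x y (+) level b x y) =
  crosses a b x (+) (level a x x (+) level b x x).
Proof.
move=> off a1 a2 b1 b2 o1 o2.
(* At a height between those of the ends, a zero orientation would put [x] on the segment, at the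
   displayed parameter. *)
have off0 : a.2 != b.2 -> 0 <= (x.2 - a.2) / (b.2 - a.2) <= 1 -> orient a b x <> 0.
  move=> ab t01 o0; apply: (off _ t01); apply: vec_eq; rewrite !coordE.
    apply/eqP; rewrite -subr_eq0; apply/eqP.
    transitivity (orient a b x / (b.2 - a.2)); last by rewrite o0 mul0r.
    by rewrite /orient /cross !coordE; field; rewrite subr_eq0 eq_sym.
  by field; rewrite subr_eq0 eq_sym.
have oE : orient a b x = (b.1 - a.1) * (x.2 - a.2) - (b.2 - a.2) * (x.1 - a.1).
  by rewrite /orient /cross !coordE.
have sgn : orient a b x <> 0 ->
    (0 < orient a b y) = (0 < orient a b x) /\ (orient a b y < 0) = (orient a b x < 0).
  case: (ltgtP (orient a b x) 0) o1 o2 => [_ _ /(_ isT) h|_ /(_ isT) h|//] _.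
    by rewrite h (lt_gtF h).
  by rewrite h (lt_gtF h).
have xa : x <> a by move=> e; apply: (off 0); rewrite ?lexx ?ler01 // scale0r addr0.
have xb : x <> b by move=> e; apply: (off 1); rewrite ?lexx ?ler01 // scale1r subrKC.
rewrite /crosses /level.
(* Nine cases, by the heights of both ends relative to [x]. When just one end is level with [x], the
   sign of [orient a b x] tells whether that end is left or right of [x]. *)
case: (ltgtP a.2 x.2) a1 a2 => [ha /(_ isT) ya _|ha _ /(_ isT) ya|ha _ _];
case: (ltgtP b.2 x.2) b1 b2 => [hb /(_ isT) yb _|hb _ /(_ isT) yb|hb _ _] /=.
- by rewrite (lt_gtF ya) (lt_gtF yb) !andbF.
- rewrite (ltW ya) yb /=; have [|-> _ //] := sgn _; apply: off0; first by lra.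
  by rewrite divr_ge0 ?ler_pdivrMr /=; lra.
- have oxE : orient a b x = (b.2 - a.2) * (b.1 - x.1) by rewrite oE hb; ring.
  have [|-> _] := sgn _.
    move/eqP; rewrite oxE mulf_eq0 !subr_eq0 => /orP[/eqP|/eqP] e; first by lra.
    by apply: xb; apply: vec_eq.
  rewrite (ltW ya) (lt_gtF ya) oxE pmulr_rgt0 ?subr_gt0 ?hb // !andbF /= ?andbF.
  by case: ifP; rewrite ?andbT ?andbF ?addbb.
- rewrite (lt_gtF yb) andbF (ltW yb) ya /=; have [|_ -> //] := sgn _; apply: off0; first by lra.
  by apply/andP; split; rewrite ?ler_ndivlMr ?ler_ndivrMr; lra.
- by rewrite (lt_geF ya) (lt_geF yb).
- have oxE : orient a b x = (b.2 - a.2) * (b.1 - x.1) by rewrite oE hb; ring.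
  have [|_ e] := sgn _.
    move/eqP; rewrite oxE mulf_eq0 !subr_eq0 => /orP[/eqP|/eqP] e; first by lra.
    by apply: xb; apply: vec_eq.
  rewrite e (lt_geF ya) ya /= andbT oxE nmulr_rlt0 ?subr_lt0 ?subr_gt0 ?hb // andbF addbF.
  by case: (ltP y.2 x.2); case: (x.1 < b.1).
- have oxE : orient a b x = (b.2 - a.2) * (a.1 - x.1) by rewrite oE -ha; ring.
  have [|_ e] := sgn _.
    move/eqP; rewrite oxE mulf_eq0 !subr_eq0 => /orP[/eqP|/eqP] e; first by lra.
    by apply: xa; apply: vec_eq.
  rewrite e (lt_gtF yb) andbF (ltW yb) /= oxE nmulr_rlt0 ?subr_lt0 ?subr_gt0 ?ha // andbF !addbF.
  by case: (ltP y.2 x.2); case: (x.1 < a.1).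
- have oxE : orient a b x = (b.2 - a.2) * (a.1 - x.1) by rewrite oE -ha; ring.
  have [|e _] := sgn _.
    move/eqP; rewrite oxE mulf_eq0 !subr_eq0 => /orP[/eqP|/eqP] e; first by lra.
    by apply: xa; apply: vec_eq.
  rewrite e yb (lt_geF yb) andbT /= oxE pmulr_rgt0 ?subr_gt0 ?ha // andbF !addbF.
  by case: (ltP y.2 x.2); case: (x.1 < a.1).
- have ab : a.2 = b.2 by rewrite ha hb.
  have -> : (a.2 <= y.2 < b.2) = false by rewrite ab; case: leP.
  have -> : (b.2 <= y.2 < a.2) = false by rewrite ab; case: leP.
  rewrite !andbF ab; suff -> : (x.1 < a.1) = (x.1 < b.1) by rewrite addbb.
  apply/idP/idP => h1; rewrite ltNge; apply/negP => h2.
    have ne : b.1 - a.1 != 0 by lra.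
    apply: (off ((x.1 - a.1) / (b.1 - a.1))).
      by apply/andP; split; rewrite ?ler_ndivlMr ?ler_ndivrMr; lra.
    by apply: vec_eq; rewrite !coordE; [field | rewrite ab subrr mulr0 addr0].
  have ne : b.1 - a.1 != 0 by lra.
  apply: (off ((x.1 - a.1) / (b.1 - a.1))).
    by apply/andP; split; rewrite ?ler_pdivlMr ?ler_pdivrMr; lra.
  by apply: vec_eq; rewrite !coordE; [field | rewrite ab subrr mulr0 addr0].
Qed.

Lemma orient_continuous a b : continuous (orient a b).
Proof.
move=> x; rewrite /orient /cross.
apply: cvgB; (apply: cvgM; first exact: cvg_cst).
  by apply: (@cvgB _ _ _ _ _ (fun x : R * R => x.2) (cst a.2)); [exact: cvg_snd | exact: cvg_cst].
by apply: (@cvgB _ _ _ _ _ (fun x : R * R => x.1) (cst a.1)); [exact: cvg_fst | exact: cvg_cst].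
Qed.

End Crossing.

(** * The even-odd rule *)

Section Parity.
Variables (R : realType) (n : nat) (p : 'I_n -> R * R).
Implicit Types (i j : 'I_n) (s t : R) (x y z a b d : R * R).

Lemma near_lt_stable (f : R * R -> R) x (c : R) : {for x, continuous f} ->
  \forall y \near x, (c < f x -> c < f y) /\ (f x < c -> f y < c).
Proof.
move=> cf.
have FF : Filter (nbhs x) by exact: nbhs_filter.
case: (ltgtP c (f x)) => h.
- have := @cvgr_gt _ _ (nbhs x) FF f (f x) cf c h.
  by apply: (@filterS _ (nbhs x) FF) => y hy; split.
- have := @cvgr_lt _ _ (nbhs x) FF f (f x) cf c h.
  by apply: (@filterS _ (nbhs x) FF) => y hy; split.
- by apply: (@nearW _ (nbhs x) _ FF) => y; split.
Qed.

Lemma near_crosses_stable a b x :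
    (forall t, 0 <= t <= 1 -> a + t *: (b - a) <> x) ->
  \forall y \near x,
    crosses a b y (+) (level a x y (+) level b x y) =
    crosses a b x (+) (level a x x (+) level b x x).
Proof.
move=> off.
have na c : \forall y \near x, (c < x.2 -> c < y.2) /\ (x.2 < c -> y.2 < c).
  by apply: near_lt_stable; exact: cvg_snd.
have no := near_lt_stable 0 (@orient_continuous _ a b x).
have h1 := na a.2; have h2 := na b.2.
near=> y; have [//|a1 a2] := near h1 y; have [//|b1 b2] := near h2 y.
have [//|o1 o2] := near no y.
exact: crosses_stable.
Unshelve. all: by end_near. Qed.

(** Every value of [f] occurs twice in the cyclic sum. *)
Lemma xor_ordS (f : 'I_n -> bool) :
  \big[addb/false]_i (f i (+) f (ordS i)) = false.
Proof.
rewrite big_split /= [X in X (+) _](_ : _ = \big[addb/false]_i f (ordS i)) ?addbb //.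
rewrite (reindex (@ordS n)) //.
by exists (@ord_pred n) => i _; rewrite ?ordSK ?ord_predK.
Qed.

Definition parity x : bool := \big[addb/false]_i crosses (p i) (p (ordS i)) x.

(** Adding the [level] terms makes each summand locally constant and does not change the total,
    since these terms cancel around the polygon. *)
Lemma parity_near x : ~ boundary p x -> \forall y \near x, parity y = parity x.
Proof.
move=> offx.
have H : \forall y \near x, forall i,
    crosses (p i) (p (ordS i)) y (+) (level (p i) x y (+) level (p (ordS i)) x y) =
    crosses (p i) (p (ordS i)) x (+) (level (p i) x x (+) level (p (ordS i)) x x).
  apply: (filter_forall (nbhs_filter x)) => i; apply: near_crosses_stable.
  by move=> t t01 e; apply: offx; exists i, t.
apply: filterS H => y yH.
have pE z : parity z = \big[addb/false]_i
    (crosses (p i) (p (ordS i)) z (+) (level (p i) x z (+) level (p (ordS i)) x z)).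
  by rewrite big_split /= (xor_ordS (fun i => level (p i) x z)) addbF.
by rewrite !pE; apply: eq_bigr => i _.
Qed.

(** Both values of the parity are taken on open subsets of the complement, so a connected component
    sees only one of them. *)
Lemma parity_reach x y : reach p x y -> parity x = parity y.
Proof.
move=> xy; pose C := connected_component (~` boundary p) x.
pose S (b : bool) := [set z | ~ boundary p z /\ parity z = b].
have opS (b : bool) : open (S b).
  rewrite openE => z [nz zb]; rewrite /interior.
  have h1 := near_off_boundary nz; have h2 := parity_near nz.
  near=> w; split; first by near: w.
  by rewrite -zb; near: w.
have Cx : C x by apply: connected_component_refl; exact: reach_off (reach_sym xy).
have off z : C z -> ~ boundary p z by exact: connected_component_sub.
suff : C `&` S (parity x) = C by move=> h; have : C y := xy; rewrite -h => -[_ []].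
apply: (@component_connected _ (~` boundary p) x).
- by exists x; split => //; split => //; exact: off.
- by exists (S (parity x)).
- exists (~` S (~~ parity x)); first exact: open_closedC.
  apply/seteqP; split=> z [Cz Sz]; split=> //.
    by case: Sz => _ <- [_]; case: (parity z).
  split; first exact: off.
  case: (boolP (parity z == parity x)) => [/eqP //|ne]; case: Sz; split; first exact: off.
  by move: ne; case: (parity z); case: (parity x).
Unshelve. all: by end_near. Qed.

(** A single crossing side yields the upper, lower and right bounds. For a point left of all the
    vertices, a side is crossed exactly when its ends are separated by the level of the point, which
    happens an even number of times around. *)
Lemma parity_bounded x : parity x ->
  exists i j k l, [/\ (p i).1 <= x.1, x.1 <= (p j).1, (p k).2 <= x.2 & x.2 <= (p l).2].
Proof.
move=> px.
have [i crs] : exists i, crosses (p i) (p (ordS i)) x.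
  apply: contrapT => no; move: px; rewrite /parity big1 // => i _.
  by apply/negbTE/negP => h; apply: no; exists i.
have [k [l [kx lx]]] : exists k l, (p k).2 <= x.2 /\ x.2 <= (p l).2.
  move: crs; rewrite /crosses; case: ifP => [/andP[h1 h2] _|_].
    by exists i, (ordS i); rewrite h1 ltW.
  by case: ifP => [/andP[h1 h2] _|//]; exists (ordS i), i; rewrite h1 ltW.
have [j jx] : exists j, x.1 <= (p j).1.
  apply: contrapT => no; have lt j : (p j).1 < x.1.
    by rewrite ltNge; apply/negP => h; apply: no; exists j.
  move: crs; have := lt i; have := lt (ordS i).
  rewrite /crosses /orient /cross !coordE => l1 l2.
  case: ifP => [/andP[h1 h2]|_]; first by nra.
  by case: ifP => [/andP[h1 h2]|//]; nra.
suff [m mx] : exists m, (p m).1 <= x.1 by exists m, j, k, l.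
apply: contrapT => no; have lt m : x.1 < (p m).1.
  by rewrite ltNge; apply/negP => h; apply: no; exists m.
move: px; rewrite /parity.
rewrite (eq_bigr (fun i => ((p i).2 <= x.2) (+) ((p (ordS i)).2 <= x.2))).
  by rewrite (xor_ordS (fun i => (p i).2 <= x.2)).
move=> m _; have := lt m; have := lt (ordS m).
rewrite /crosses /orient /cross !coordE => l1 l2.
case: (leP (p m).2 x.2) => h1; case: (leP (p (ordS m)).2 x.2) => h2 //=.
- by nra.
- by nra.
Qed.

(** The whole component of [x] has odd parity, and odd points stay in the bounding box of the
    vertices. *)
Lemma parity_inside x : ~ boundary p x -> parity x -> inside p x.
Proof.
move=> nx px; split=> //.
pose M := \sum_i (`|(p i).1| + `|(p i).2|).
have Mi i : `|(p i).1| + `|(p i).2| <= M.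
  by rewrite /M (bigD1 i) //= lerDl sumr_ge0 // => j _; rewrite addr_ge0.
have M1 i : `|(p i).1| <= M by apply: le_trans (Mi i); rewrite lerDl.
have M2 i : `|(p i).2| <= M by apply: le_trans (Mi i); rewrite lerDr.
exists M; split; first exact: num_real.
move=> M' MM' y /= /parity_reach xy.
have [i [j [k [l [h1 h2 h3 h4]]]]] : exists i j k l,
    [/\ (p i).1 <= y.1, y.1 <= (p j).1, (p k).2 <= y.2 & y.2 <= (p l).2].
  by apply: parity_bounded; rewrite -xy.
rewrite prod_normE ge_max !ler_norml.
have := M1 i; have := M1 j; have := M2 k; have := M2 l.
rewrite !ler_norml => /andP[? ?] /andP[? ?] /andP[? ?] /andP[? ?].
by apply/andP; split; apply/andP; split; lra.
Qed.


(** The witnesses are just left and just right of the middle of side [i], at the same level, so that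
    the [level] terms agree and the crossings with all other sides are the same; only the crossing
    with side [i] differs. *)
Lemma parity_jump (hp : simple_polygon p) s i :
    0 < s * ((p (ordS i)).2 - (p i).2) ->
  exists x y, [/\ beside p s i x, beside p (- s) i y & parity x != parity y].
Proof.
move=> si; pose h : R * R := (1, 0); pose m := mid p i.
have offm j : j != i -> forall t, 0 <= t <= 1 ->
    p j + t *: (p (ordS j) - p j) <> m.
  move=> ji t t01 e; have h1 : 0 <= (1 / 2 : R) <= 1 by lra.
  case: (@sides_meet _ _ _ hp j i t (1 / 2) t01 h1 e) => [[/eqP]|[_ _ ?]|[_ _ ?]].
  - by rewrite (negbTE ji).
  - by lra.
  - by lra.
have nj : \forall y \near m, forall j, j != i -> y.2 = m.2 ->
    crosses (p j) (p (ordS j)) y = crosses (p j) (p (ordS j)) m.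
  apply: (filter_forall (nbhs_filter m)) => j.
  have [->|ji] := eqVneq j i; first by apply: nearW.
  apply: filterS (near_crosses_stable (offm j ji)) => y + _ ym.
  by rewrite /level ym => /addIb.
have hj d : d.2 = 0 -> \forall e \near (0 : R)^'+, forall j, j != i ->
    crosses (p j) (p (ordS j)) (m + e *: d) = crosses (p j) (p (ordS j)) m.
  move=> d0; have hh : \forall e \near (0 : R)^'+, forall j, j != i -> (m + e *: d).2 = m.2 ->
      crosses (p j) (p (ordS j)) (m + e *: d) = crosses (p j) (p (ordS j)) m.
    by exact: (@near_ray _ m d _ nj).
  apply: filterS hh => e he j ji.
  by apply: he => //; rewrite !coordE d0 mulr0 addr0.
have b1 : 0 < s * cross (edge p i) (- h).
  suff -> : cross (edge p i) (- h) = (p (ordS i)).2 - (p i).2 by [].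
  by rewrite /cross /edge !coordE /h /=; ring.
have b2 : 0 < - s * cross (edge p i) h.
  suff -> : - s * cross (edge p i) h = s * ((p (ordS i)).2 - (p i).2) by [].
  by rewrite /cross /edge !coordE /h /=; ring.
have n1 := beside_near_mid hp b1; have n2 := beside_near_mid hp b2.
have h1 := hj (- h); have h2 := hj h.
near (0 : R)^'+ => e; exists (m + e *: - h), (m + e *: h); split.
- by near: e.
- by near: e.
have e0 : 0 < e by near: e; exact: nbhs_right_gt.
have c1 : forall j, j != i -> crosses (p j) (p (ordS j)) (m + e *: - h) =
    crosses (p j) (p (ordS j)) m.
  by near: e; apply: hj; rewrite /h /= oppr0.
have c2 : forall j, j != i -> crosses (p j) (p (ordS j)) (m + e *: h) =
    crosses (p j) (p (ordS j)) m by near: e; apply: hj.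
have -> : parity (m + e *: - h) = ~~ parity (m + e *: h); last by case: parity.
rewrite /parity (bigD1 i) //= [in RHS](bigD1 i) //=.
rewrite (eq_bigr _ c1) (eq_bigr _ c2) -addNb; congr (_ (+) _).
have o c : orient (p i) (p (ordS i)) (m + e *: (c *: h)) =
    - (c * (e * ((p (ordS i)).2 - (p i).2))).
  by rewrite /orient /cross !coordE /h /=; field.
have := o (-1); have := o 1; rewrite scaleN1r scale1r mul1r mulN1r => o1 o2.
rewrite /crosses o1 o2 !coordE /h /= oppr0 mulr0 !addr0.
case: (ltgtP (p i).2 (p (ordS i)).2) si => [lt _|gt _|->]; last by rewrite subrr mulr0 ltxx.
  have -> : (p i).2 <= (p i).2 + 1 / 2 * ((p (ordS i)).2 - (p i).2) < (p (ordS i)).2.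
    by apply/andP; split; lra.
  by rewrite opprK oppr_gt0 pmulr_rgt0 // pmulr_rlt0 // subr_gt0 subr_lt0 lt (lt_gtF lt).
have -> : ((p i).2 <= (p i).2 + 1 / 2 * ((p (ordS i)).2 - (p i).2)) = false.
  by apply/negbTE; rewrite -ltNge; lra.
have -> /= : (p (ordS i)).2 <= (p i).2 + 1 / 2 * ((p (ordS i)).2 - (p i).2) < (p i).2.
  by apply/andP; split; lra.
by rewrite opprK oppr_lt0 pmulr_rgt0 // pmulr_rlt0 // subr_gt0 subr_lt0 gt (lt_gtF gt).
Unshelve. all: by end_near. Qed.

End Parity.

(** * Extreme vertices and the orientation of the polygon *)

Section Orientation.
Variables (R : realType) (n : nat) (p : 'I_n -> R * R).
Implicit Types (i j k : 'I_n) (s t : R) (x y z a b d : R * R).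

Lemma dotD d x y : dot d (x + y) = dot d x + dot d y.
Proof. by rewrite /dot !coordE; ring. Qed.

Lemma dotB d x y : dot d (x - y) = dot d x - dot d y.
Proof. by rewrite /dot !coordE; ring. Qed.

Lemma dotZ d t x : dot d (t *: x) = t * dot d x.
Proof. by rewrite /dot !coordE; ring. Qed.

Lemma dotDl d e x : dot (d + e) x = dot d x + dot e x.
Proof. by rewrite /dot !coordE; ring. Qed.

Lemma dotZl t d x : dot (t *: d) x = t * dot d x.
Proof. by rewrite /dot !coordE; ring. Qed.

Lemma dotNl d x : dot (- d) x = - dot d x.
Proof. by rewrite /dot !coordE; ring. Qed.

Definition dotE := (dotB, dotD, dotZ).

Lemma convex_le t (a b M : R) : 0 <= t <= 1 -> a <= M -> b <= M ->
  a + t * (b - a) <= M.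
Proof.
move=> /andP[t0 t1] aM bM; rewrite -subr_ge0.
have -> : M - (a + t * (b - a)) = (1 - t) * (M - a) + t * (M - b) by ring.
by rewrite addr_ge0 // mulr_ge0 // subr_ge0.
Qed.

Lemma convex_lt t (a b M : R) : 0 <= t <= 1 -> a < M -> b < M ->
  a + t * (b - a) < M.
Proof.
move=> t01 aM bM; rewrite -subr_gt0.
have -> : M - (a + t * (b - a)) = (1 - t) * (M - a) + t * (M - b) by ring.
by rewrite convex_gt0 ?subr_gt0.
Qed.

Lemma boundary_dot_le d (M : R) x :
  (forall j, dot d (p j) <= M) -> boundary p x -> dot d x <= M.
Proof.
move=> pM [i [t t01 ->]]; rewrite /side_pt !dotE.
exact: convex_le.
Qed.

Lemma ray_not_inside x d : d != 0 ->
  (forall t, 0 <= t -> ~ boundary p (x + t *: d)) -> ~ inside p x.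
Proof.
move=> d0 ray [_ [M [_ bM]]].
have dn : 0 < `|d| by rewrite normr_gt0.
pose t := (`|M| + 2 + `|x|) / `|d|.
have t0 : 0 <= t by rewrite divr_ge0 // !addr_ge0.
have : `|x + t *: d| <= `|M| + 1.
  apply: (bM (`|M| + 1)) => /=; first by rewrite (le_lt_trans (ler_norm _)) // ltrDl.
  apply: segment_reach => c /andP[c0 _].
  by rewrite [x + t *: d - x]addrC addKr scalerA; apply: ray; rewrite mulr_ge0.
have : `|t *: d| <= `|x + t *: d| + `|x|.
  by have := ler_normB (x + t *: d) x; rewrite [x + t *: d]addrC addrK.
rewrite normrZ (ger0_norm t0) /t divfK ?gt_eqF //; lra.
Qed.

Lemma dot_gt_outside x d : (forall j, dot d (p j) < dot d x) -> 'I_n -> ~ region p x.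
Proof.
move=> dx i0; case=> [[i [t t01 e]]|].
  have := convex_lt t01 (dx i) (dx (ordS i)).
  have -> : dot d (p i) + t * (dot d (p (ordS i)) - dot d (p i)) = dot d x.
    by rewrite e /side_pt !dotE.
  by rewrite ltxx.
have d0 : d != 0.
  by apply/eqP => d0; have := dx i0; rewrite d0 /dot /= !mul0r ltxx.
apply: (ray_not_inside d0) => t t0 [i [c c01 e]].
have : dot d (x + t *: d) < dot d x.
  by rewrite e /side_pt !dotE convex_lt.
by rewrite !dotE; have := dot_ge0 d => dd; rewrite ltNge lerDl mulr_ge0.
Qed.

(** Support-functional form of the inclusion of the region in the convex hull of the vertices; no
    convex combination has to be exhibited. *)
Lemma region_support x : 'I_n -> region p x ->
  forall d, exists j, dot d x <= dot d (p j).
Proof.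
move=> i0 rx d; apply: contrapT => no; apply: (@dot_gt_outside x d) rx => // j.
by rewrite ltNge; apply/negP => h; apply: no; exists j.
Qed.

(** A lexicographic inequality for the pair [a], [b] becomes strict for [a + e *: b] with [e] small,
    the family of vectors being finite. *)
Lemma perturb_direction (v : 'I_n -> R * R) (P : pred 'I_n) a b :
  (forall j, P j -> dot a (v j) < 0 \/ dot a (v j) = 0 /\ dot b (v j) < 0) ->
  exists d, forall j, P j -> dot d (v j) < 0.
Proof.
move=> H.
have H' : \forall e \near (0 : R)^'+, forall j, P j -> dot (a + e *: b) (v j) < 0.
  apply: (filter_forall (at_right_proper_filter 0)) => j.
  have [Pj|] := boolP (P j); last by move=> ?; apply: nearW.
  case: (H j Pj) => [lt|[eq lt]].
    have cv : dot a (v j) + e * dot b (v j) @[e --> (0 : R)^'+] --> dot a (v j).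
      rewrite -[X in _ --> X]addr0 -[X in _ + X](mul0r (dot b (v j))).
      apply: cvgD; first exact: cvg_cst.
      by apply: cvgMl; apply: cvg_at_right_filter; exact: cvg_id.
    have h := cvgr_lt _ cv 0 lt.
    by near=> e => _; rewrite dotDl dotZl; near: e; exact: h.
  near=> e => _; have e0 : 0 < e by near: e; exact: nbhs_right_gt.
  by rewrite dotDl dotZl eq add0r pmulr_rlt0.
have [e he] := @filter_ex _ _ (at_right_proper_filter (0 : R)) _ H'.
by exists (a + e *: b).
Unshelve. all: by end_near. Qed.

Hypothesis hp : simple_polygon p.

(** Ties for [a] are broken by [perp a]; vertices being distinct, the winner is unique, and tilting
    [a] a little makes it a strict maximum. *)
Lemma extreme_vertex a : 'I_n -> a != 0 -> exists i,
  (forall j, dot a (p j) <= dot a (p i)) /\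
  exists d, forall j, j != i -> dot d (p j) < dot d (p i).
Proof.
move=> i0 a0.
have [i1 _ max1] := @arg_maxP _ R _ i0 xpredT (fun i => dot a (p i)) isT.
pose Q := [pred i | dot a (p i) == dot a (p i1)].
have [i Qi max2] := @arg_maxP _ R _ i1 Q (fun i => dot (perp a) (p i)) (eqxx _).
exists i; split; first by move=> j; rewrite (eqP Qi); exact: max1.
have [|d hd] := perturb_direction (v := fun j => p j - p i) (P := predC1 i) (a := a) (b := perp a).
  move=> j /= ji; rewrite !dotB.
  have m1 : dot a (p j) <= dot a (p i1) := max1 j isT.
  move: m1; rewrite -(eqP Qi) le_eqVlt => /orP[/eqP e|]; last by left; rewrite subr_lt0.
  right; split; first by rewrite e subrr.
  have Qj : Q j by rewrite /= e.
  have m2 : dot (perp a) (p j) <= dot (perp a) (p i) := max2 j Qj.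
  rewrite subr_lt0 lt_neqAle m2 andbT; apply/eqP => e'.
  case/negP: ji; apply/eqP/(vertex_inj hp).
  have aa : 0 < dot a a by rewrite dot_gt0.
  have e1 : dot a (p j - p i) = 0 by rewrite dotB e subrr.
  have e2 : dot (perp a) (p j - p i) = 0 by rewrite dotB e' subrr.
  apply/eqP; rewrite -subr_eq0; apply/eqP; set v := p j - p i in e1 e2 *.
  apply: vec_eq; apply: (mulfI (lt0r_neq0 aa)); rewrite mulr0.
    transitivity (a.1 * dot a v - a.2 * dot (perp a) v); last by rewrite e1 e2; ring.
    by rewrite /dot /perp /=; ring.
  transitivity (a.2 * dot a v + a.1 * dot (perp a) v); last by rewrite e1 e2; ring.
  by rewrite /dot /perp /=; ring.
by exists d => j ji; have := hd j ji; rewrite dotB subr_lt0.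
Qed.

Lemma beside_scale s s' i x : 0 < s * s' -> beside p s i x -> beside p s' i x.
Proof.
move=> ss sx; have sb : 0 < s * cross (edge p i) (s' *: perp (edge p i)).
  have -> : s * cross (edge p i) (s' *: perp (edge p i)) =
     s * s' * dot (edge p i) (edge p i) by rewrite /cross /dot !coordE /perp /=; ring.
  by rewrite mulr_gt0 // dot_gt0 edge_neq0.
by apply: filterS (beside_near_mid hp sb) => e se; exact: reach_beside se sx.
Qed.

(** The side arriving at a strict maximum increases [d] and the one leaving it decreases [d], so
    they are not aligned. On the outer flank, the direction [u - w] increases [d] and gives a ray
    that never meets the boundary again. *)
Lemma extreme_beside d i :
    (forall j, j != ordS i -> dot d (p j) < dot d (p (ordS i))) ->
  let c := cross (edge p i) (edge p (ordS i)) in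
  c != 0 /\ (forall x, beside p (- c) i x -> ~ inside p x).
Proof.
move=> max; set u := edge p i; set w := edge p (ordS i) => c.
have du : 0 < dot d u by rewrite /u dotB subr_gt0 max // eq_sym (ordS_neq hp).
have dw : dot d w < 0 by rewrite /w dotB subr_lt0 max // (ordS_neq hp).
have c0 : c != 0.
  apply/eqP => /(aligned_edges hp) [k k0]; rewrite -/u -/w => e.
  by move: dw; rewrite e dotZ ltNge mulr_ge0 // ltW.
split=> // x bx.
have cc : 0 < c ^+ 2 by rewrite exprn_even_gt0.
have b1 : 0 < - c * cross u (u - w).
  suff -> : - c * cross u (u - w) = c ^+ 2 by [].
  by rewrite /c /cross !coordE; ring.
have b2 : 0 < - c * cross w (u - w).
  suff -> : - c * cross w (u - w) = c ^+ 2 by [].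
  by rewrite /c /cross !coordE; ring.
have db : 0 < dot d (u - w) by rewrite dotB; lra.
have h := beside_corner hp b1 b2.
near (0 : R)^'+ => e; have [//|be _] := near h e.
have e0 : 0 < e by near: e; exact: nbhs_right_gt.
move=> /(reach_inside (reach_beside bx be)); apply: (@ray_not_inside _ (u - w)).
  by apply/eqP => z; move: db; rewrite z /dot /= !mulr0 addr0 ltxx.
move=> t t0 bd; have : dot d (p (ordS i) + e *: (u - w) + t *: (u - w)) <= dot d (p (ordS i)).
  apply: boundary_dot_le bd => j; have [->//|ji] := eqVneq j (ordS i).
  by rewrite ltW // max.
rewrite !dotD !dotZ -addrA -mulrDl leNgt ltrDl mulr_gt0 //; lra.
Unshelve. all: by end_near. Qed.

(* [s] is 1 for a counterclockwise polygon and -1 for a clockwise one. *)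
Definition oriented s : Prop :=
  [/\ s = 1 \/ s = - 1, forall i x, beside p s i x -> inside p x &
      forall i x, beside p (- s) i x -> ~ inside p x].

Lemma oriented_neq0 s : oriented s -> s != 0.
Proof. by case=> [[] -> _ _]; rewrite ?oppr_eq0 oner_eq0. Qed.

Lemma beside_exists s i : s != 0 -> exists x, beside p s i x.
Proof.
move=> s0; have [b [b1 b2]] := corner_direction hp i s0.
by have [e [e1 _]] := filter_ex (beside_corner hp b1 b2); exists (p (ordS i) + e *: b).
Qed.

Lemma ord_predP (P : 'I_n -> Prop) : (forall i, P (ordS i)) -> forall i, P i.
Proof. by move=> h i; rewrite -(ord_predK i). Qed.

(** Across a non-horizontal side the parity jumps, so one flank is odd and hence inside; the outer
    flank at an extreme vertex is not inside. As each sign has a single component, these must be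
    opposite signs and the answer is the same at all sides. *)
Lemma oriented_exists : 'I_n -> exists s, oriented s.
Proof.
move=> i0.
have e1 : ((1, 0) : R * R) != 0 by rewrite -dot_gt0 /dot /= mulr1 mulr0 addr0.
have [i [_ [d max]]] := extreme_vertex i0 e1.
elim/ord_predP: i max => i max.
have [c0 out] := extreme_beside max.
have [j hj] : exists j, (p (ordS j)).2 - (p j).2 != 0.
  apply: contrapT => no; case/negP: c0; apply/eqP.
  have z j : (edge p j).2 = 0.
    by apply/eqP/negPn/negP => h; apply: no; exists j.
  by rewrite /cross !z mulr0 mul0r subrr.
set c := cross _ _ in c0 out.
have [s [s1 [k [x [bx px]]]]] : exists s, (s = 1 \/ s = - 1) /\
    exists k x, beside p s k x /\ parity p x.
  have [s s1 sj] : exists2 s : R, s = 1 \/ s = - 1 & 0 < s * ((p (ordS j)).2 - (p j).2).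
    move: hj; case: (ltgtP ((p (ordS j)).2 - (p j).2) 0) => // h _.
      by exists (- 1); [right | rewrite mulN1r oppr_gt0].
    by exists 1; [left | rewrite mul1r].
  have [x [y [bx bY]]] := parity_jump hp sj.
  case px: (parity p x); first by exists s; split => //; exists j, x.
  case py: (parity p y) => // _; exists (- s); split; last by exists j, y.
  by case: s1 => ->; [right | left; rewrite opprK].
have s0 : s != 0 by case: s1 => ->; rewrite ?oppr_eq0 oner_eq0.
have inx : inside p x by apply: parity_inside => //; exact: beside_off bx.
have sin l y : beside p s l y -> inside p y.
  by move=> /(beside_all hp k s0) by_; apply: reach_inside inx; exact: reach_beside by_.
have sc : 0 < c * s.
  rewrite ltNge le_eqVlt mulf_eq0 (negbTE c0) (negbTE s0) /=; apply/negP => lt.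
  apply: (out x) inx; apply: (@beside_scale s); first by rewrite mulrN oppr_gt0 mulrC.
  exact: beside_all bx.
exists s; split=> // l y bY; apply: out; apply: (@beside_scale (- s)).
  by rewrite mulrNN mulrC.
by apply: beside_all bY; rewrite // oppr_eq0.
Qed.

Lemma extreme_turn s d i : oriented s ->
    (forall j, j != ordS i -> dot d (p j) < dot d (p (ordS i))) ->
  0 < s * cross (edge p i) (edge p (ordS i)).
Proof.
move=> os max; have [c0 out] := extreme_beside max.
have s0 := oriented_neq0 os; case: os => _ ins _.
rewrite ltNge le_eqVlt mulf_eq0 (negbTE c0) (negbTE s0) /=; apply/negP => lt.
have [x bx] := beside_exists i s0.
apply: (out x) (ins i x bx); apply: beside_scale bx.
by rewrite mulrN oppr_gt0.
Qed.

(** A small open sector between two nonaligned sides is convex and off the boundary, so each of its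
    points is joined to the points that [beside_corner] supplies in the direction [w - u]. *)
Lemma sector_beside i : let u := edge p i in let w := edge p (ordS i) in
  cross u w != 0 ->
  exists2 r : R, 0 < r & forall a b : R, 0 < a < r -> 0 < b < r ->
    beside p (cross u w) i (p (ordS i) + a *: w - b *: u).
Proof.
move=> u w c0; set v := p (ordS i).
pose g (ab : R * R) := v + ab.1 *: w - ab.2 *: u.
have offv j t : predC (pred2 i (ordS i)) j -> 0 <= t <= 1 -> side_pt p j t <> v.
  move=> /= jP t01; rewrite /v -(side_pt1 p i) => e.
  have h1 : 0 <= (1 : R) <= 1 by rewrite ler01 lexx.
  case: (@sides_meet _ _ _ hp j i t 1 t01 h1 e) jP => [[-> _]|[_ _ /eqP]|[-> _ _]].
  - by rewrite eqxx.
  - by rewrite oner_eq0.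
  - by rewrite eqxx orbT.
have cg : g ab @[ab --> nbhs (0 : R * R)] --> v.
  have -> : v = v + (0 : R) *: w - (0 : R) *: u by rewrite !scale0r subr0 addr0.
  apply: cvgB; first (apply: cvgD; first exact: cvg_cst).
    by apply: cvgZr_tmp; exact: cvg_fst.
  by apply: cvgZr_tmp; exact: cvg_snd.
have /nbhs_ballP [r /= r0 hr] : \forall ab \near (0 : R * R), forall j t,
    predC (pred2 i (ordS i)) j -> 0 <= t <= 1 -> side_pt p j t <> g ab.
  exact: (cg _ (near_off_sides offv)).
have off (a b : R) : 0 < a < r -> 0 < b < r -> ~ boundary p (g (a, b)).
  move=> /andP[a0 ar] /andP[b0 br] [j [t t01 e]].
  have [jP|] := boolP (predC (pred2 i (ordS i)) j).
    apply: (hr (a, b) _ j t) => //.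
    by split; rewrite -ball_normE /ball_ /= sub0r normrN gtr0_norm.
  move=> /negPn /orP [/eqP|/eqP] ji; subst j.
    have : a * cross u w = 0.
      transitivity (cross u (g (a, b) - v)); first by rewrite /g /cross !coordE /=; ring.
      by rewrite e side_ptE -/u -/v /cross !coordE; ring.
    by apply/eqP; rewrite mulf_neq0 // gt_eqF.
  have : b * cross u w = 0.
    transitivity (cross w (g (a, b) - v)); first by rewrite /g /cross !coordE /=; ring.
    by rewrite e /side_pt -/(edge _ _) -/w -/v /cross !coordE; ring.
  by apply/eqP; rewrite mulf_neq0 // gt_eqF.
exists r => // a b ar br.
have cc : 0 < cross u w ^+ 2 by rewrite exprn_even_gt0.
have b1 : 0 < cross u w * cross u (w - u).
  suff -> : cross u w * cross u (w - u) = cross u w ^+ 2 by [].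
  by rewrite /cross !coordE; ring.
have b2 : 0 < cross u w * cross w (w - u).
  suff -> : cross u w * cross w (w - u) = cross u w ^+ 2 by [].
  by rewrite /cross !coordE; ring.
have h := beside_corner hp b1 b2.
near (0 : R)^'+ => e; have [//|be _] := near h e.
have e0 : 0 < e by near: e; exact: nbhs_right_gt.
have er : e < r by near: e; exact: nbhs_right_lt.
apply: beside_reach be _; apply: segment_reach => t t01.
have -> : p (ordS i) + e *: (w - u) + t *: (v + a *: w - b *: u - (p (ordS i) + e *: (w - u))) =
    g ((1 - t) * e + t * a, (1 - t) * e + t * b).
  by rewrite /g /v; apply: vec_eq; rewrite !coordE /=; ring.
have cv c : 0 < c < r -> 0 < (1 - t) * e + t * c < r.
  move=> /andP[c1 c2]; rewrite convex_gt0 //= -subr_gt0.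
  have -> : r - ((1 - t) * e + t * c) = (1 - t) * (r - e) + t * (r - c) by ring.
  by rewrite convex_gt0 ?subr_gt0.
by apply: off; apply: cv.
Unshelve. all: by end_near. Qed.

Lemma sector_insideP s i : oriented s ->
    cross (edge p i) (edge p (ordS i)) != 0 ->
  sector_inside p (ordS i) <-> 0 < s * cross (edge p i) (edge p (ordS i)).
Proof.
move=> os c0; have s0 := oriented_neq0 os; case: os => _ ins out.
have [r r0 hr] := sector_beside c0; set c := cross _ _ in c0 hr *.
have ptE (a b : R) : p (ordS i) + a *: (p (ordS (ordS i)) - p (ordS i)) +
     b *: (p (ord_pred (ordS i)) - p (ordS i)) =
   p (ordS i) + a *: edge p (ordS i) - b *: edge p i.
  by rewrite ordSK /edge; apply: vec_eq; rewrite !coordE; ring.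
split=> [[e e0 he]|sc]; last first.
  exists r => // a b ar br; rewrite ptE; apply: (ins i).
  by apply: beside_scale (hr a b ar br); rewrite mulrC.
rewrite ltNge le_eqVlt mulf_eq0 (negbTE c0) (negbTE s0) /=; apply/negP => lt.
pose m := Num.min e r / 2.
have [m0 me mr] : [/\ 0 < m, m < e & m < r].
  rewrite /m; have : 0 < Num.min e r by rewrite lt_min e0 r0.
  have : Num.min e r <= e by rewrite ge_min lexx.
  have : Num.min e r <= r by rewrite ge_min lexx orbT.
  by move=> h1 h2 h3; split; lra.
have := he m m; rewrite m0 me ptE => /(_ isT isT); apply: (out i).
apply: beside_scale (hr m m _ _); rewrite ?m0 ?mr //.
by rewrite mulrN oppr_gt0 mulrC.
Qed.

End Orientation.

(** * Sines and cosines of angles *)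

Section Angle.
Variable R : realType.
Implicit Types (u v w x y : R * R) (s t : R).

Lemma lagrange_identity u v :
  dot u v ^+ 2 + cross u v ^+ 2 = dot u u * dot v v.
Proof. by rewrite /dot /cross; ring. Qed.

Lemma elen_ge0 u : 0 <= elen u.
Proof. exact: sqrtr_ge0. Qed.

Lemma elen_gt0 u : (0 < elen u) = (u != 0).
Proof. by rewrite sqrtr_gt0 dot_gt0. Qed.

Lemma sqr_elen u : elen u ^+ 2 = dot u u.
Proof. by rewrite sqr_sqrtr ?dot_ge0. Qed.

Lemma cross_neq0 u v : cross u v != 0 -> u != 0 /\ v != 0.
Proof.
by move=> c0; split; apply/eqP => e; move: c0; rewrite e /cross /= ?(mul0r, mulr0) subrr eqxx.
Qed.

Lemma cos_ratio_itv u v : u != 0 -> v != 0 ->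
  -1 <= dot u v / (elen u * elen v) <= 1.
Proof.
move=> u0 v0; have N0 : 0 < elen u * elen v by rewrite mulr_gt0 // elen_gt0.
rewrite -ler_norml normrM normfV (gtr0_norm N0) ler_pdivrMr // mul1r.
rewrite -(@ler_pXn2r _ 2) ?nnegrE ?(ltW N0) // exprMn !sqr_elen -lagrange_identity.
by rewrite real_normK ?num_real // lerDl sqr_ge0.
Qed.

Lemma angle_itv u v : u != 0 -> v != 0 -> 0 <= angle u v <= pi.
Proof.
by move=> u0 v0; rewrite acos_ge0 ?acos_lepi ?cos_ratio_itv.
Qed.

Lemma cos_angle u v : u != 0 -> v != 0 ->
  cos (angle u v) = dot u v / (elen u * elen v).
Proof. by move=> u0 v0; rewrite acosK // in_itv /= cos_ratio_itv. Qed.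

Lemma sin_angle u v : u != 0 -> v != 0 ->
  sin (angle u v) = `|cross u v| / (elen u * elen v).
Proof.
move=> u0 v0; have N0 : 0 < elen u * elen v by rewrite mulr_gt0 // elen_gt0.
rewrite sin_acos ?cos_ratio_itv // -[RHS]ger0_norm ?divr_ge0 ?(ltW N0) // -sqrtr_sqr.
congr Num.sqrt; rewrite !expr_div_n real_normK ?num_real //.
have N2 : (elen u * elen v) ^+ 2 = dot u v ^+ 2 + cross u v ^+ 2.
  by rewrite exprMn !sqr_elen lagrange_identity.
have : (elen u * elen v) ^+ 2 != 0 by rewrite expf_neq0 ?gt_eqF.
by rewrite N2 => h; rewrite -[1](divff h) -mulrBl addrAC subrr add0r.
Qed.

Lemma angle_lt_pi u v : cross u v != 0 -> angle u v < pi.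
Proof.
move=> c0; have [u0 v0] := cross_neq0 c0.
have /andP[_ a2] := angle_itv u0 v0; rewrite lt_neqAle a2 andbT; apply/eqP => e.
have := sin_angle u0 v0; rewrite e sinpi => /esym/eqP.
by rewrite mulf_eq0 normr_eq0 (negbTE c0) invr_eq0 mulf_eq0 !gt_eqF // elen_gt0.
Qed.

Lemma angle_opposite u k : u != 0 -> 0 < k -> angle (k *: u) (- u) = pi.
Proof.
move=> u0 k0; rewrite /angle -[RHS]acosN1; congr acos.
have uu : 0 < dot u u by rewrite dot_gt0.
have -> : elen (- u) = elen u by rewrite /elen /dot /= !mulrNN.
have -> : elen (k *: u) = k * elen u.
  rewrite /elen; have -> : dot (k *: u) (k *: u) = k ^+ 2 * dot u u.
    by rewrite /dot !coordE; ring.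
  by rewrite sqrtrM ?sqr_ge0 // sqrtr_sqr gtr0_norm.
have -> : dot (k *: u) (- u) = - (k * dot u u) by rewrite /dot !coordE; ring.
by rewrite -mulrA -expr2 sqr_elen mulNr divff // mulf_neq0 ?gt_eqF.
Qed.

(** The last hypothesis makes the numerator of the sine of the angle sum negative, whereas the sine
    is nonnegative on the interval from 0 to [pi]. The sign [s] removes the absolute values of the
    cross products. *)
Lemma angle_sum_gt_pi s u v x y : s = 1 \/ s = - 1 ->
    0 < s * cross u v -> 0 < s * cross x y ->
    dot u v * (s * cross x y) + (s * cross u v) * dot x y < 0 ->
  pi < angle u v + angle x y.
Proof.
move=> s1 cuv cxy lt.
have nz c : 0 < s * c -> c != 0.
  by move=> h; apply/eqP => c0; move: h; rewrite c0 mulr0 ltxx.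
have ns c : 0 < s * c -> `|c| = s * c.
  by move=> h; rewrite -(gtr0_norm h) normrM; case: s1 => ->; rewrite ?normrN normr1 mul1r.
have [u0 v0] := cross_neq0 (nz _ cuv); have [x0 y0] := cross_neq0 (nz _ cxy).
have /andP[a1 a2] := angle_itv u0 v0; have /andP[b1 b2] := angle_itv x0 y0.
rewrite ltNge; apply/negP => le.
have : 0 <= sin (angle u v + angle x y) by apply: sin_ge0_pi; rewrite addr_ge0.
have N1 : 0 < elen u * elen v by rewrite mulr_gt0 // elen_gt0.
have N2 : 0 < elen x * elen y by rewrite mulr_gt0 // elen_gt0.
rewrite sinD !sin_angle // !cos_angle // !ns //.
set N := elen u * elen v in N1 *; set M := elen x * elen y in N2 *.
have -> : s * cross u v / N * (dot x y / M) + dot u v / N * (s * cross x y / M) =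
   (dot u v * (s * cross x y) + (s * cross u v) * dot x y) / (N * M).
  by field; rewrite !gt_eqF.
by rewrite leNgt pmulr_llt0 ?lt // invr_gt0 mulr_gt0.
Qed.

End Angle.

(** * Reflex vertices as signs of cross products *)

Section Reflex.
Variables (R : realType) (n : nat) (p : 'I_n -> R * R).
Hypothesis hp : simple_polygon p.

Lemma interior_angleE (i : 'I_n) : interior_angle p (ordS i) =
  if `[< sector_inside p (ordS i) >] then angle (edge p (ordS i)) (- edge p i)
  else 2 * pi - angle (edge p (ordS i)) (- edge p i).
Proof. by rewrite /interior_angle ordSK /edge opprB. Qed.

(** Unoriented angles are at most [pi], so only the branch [2 * pi - a] can exceed [pi]; for
    nonaligned sides [a < pi], and this branch is taken exactly when the convex sector is not
    inside. Aligned sides give [pi] in both branches. *)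
Lemma reflexP s (i : 'I_n) : oriented p s ->
  (ordS i \in reflex p) = (s * cross (edge p i) (edge p (ordS i)) < 0).
Proof.
move=> os; rewrite inE interior_angleE.
have u0 := edge_neq0 hp i; have w0 := edge_neq0 hp (ordS i).
have nu0 : - edge p i != 0 by rewrite oppr_eq0.
have pi0 : (0 : R) < pi := pi_gt0 R.
have [c0|c0] := eqVneq (cross (edge p i) (edge p (ordS i))) 0.
  have [k k0 e] := aligned_edges hp c0.
  rewrite c0 mulr0 ltxx e angle_opposite //.
  by case: ifP => _; apply/negbTE; rewrite -leNgt; lra.
have c1 : cross (edge p (ordS i)) (- edge p i) != 0.
  suff -> : cross (edge p (ordS i)) (- edge p i) = cross (edge p i) (edge p (ordS i)) by [].
  by rewrite /cross !coordE; ring.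
have lt := angle_lt_pi c1.
have s0 := oriented_neq0 os.
have sc0 : s * cross (edge p i) (edge p (ordS i)) != 0 by rewrite mulf_neq0.
case: asboolP => [/(sector_insideP hp os c0) pos|npos].
  by rewrite (lt_gtF pos); apply/negbTE; rewrite -leNgt ltW.
have -> : pi < 2 * pi - angle (edge p (ordS i)) (- edge p i) by lra.
apply/esym; rewrite lt_neqAle sc0 /= leNgt; apply/negP => pos.
by apply: npos; apply/(sector_insideP hp os c0).
Qed.

Lemma reflex_angle s (i : 'I_n) : oriented p s -> ordS i \in reflex p ->
  interior_angle p (ordS i) = 2 * pi - angle (edge p (ordS i)) (- edge p i).
Proof.
move=> os ri; move: (ri); rewrite (reflexP i os) => neg; rewrite interior_angleE.
have c0 : cross (edge p i) (edge p (ordS i)) != 0.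
  by apply/eqP => c0; move: neg; rewrite c0 mulr0 ltxx.
by case: asboolP => // /(sector_insideP hp os c0) /(lt_trans neg); rewrite ltxx.
Qed.

Lemma convex_polygonP : convex_polygon p <-> forall x y (t : R), 0 <= t <= 1 ->
  region p x -> region p y -> region p (t *: x + (1 - t) *: y).
Proof.
split=> [cp x y t /andP[t0 t1] rx ry|h x y t].
  have := cp x y (Itv01 t0 t1) (mem_set rx) (mem_set ry).
  by rewrite inE /conv /=.
rewrite !inE => rx ry; rewrite /conv /=; apply: h => //.
by rewrite ge0 le1.
Qed.

(** Two boundary points taken on the sides at a reflex vertex have their midpoint in the convex
    sector there, which lies on the outer flank. *)
Lemma reflex_not_convex : (exists i, i \in reflex p) -> ~ convex_polygon p.
Proof.
case=> i; elim/ord_predP: i => i ri /convex_polygonP cp.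
have [s os] := oriented_exists hp i.
move: ri; rewrite (reflexP i os) => neg.
have c0 : cross (edge p i) (edge p (ordS i)) != 0.
  by apply/eqP => c0; move: neg; rewrite c0 mulr0 ltxx.
have [r r0 hr] := sector_beside hp c0.
pose e := Num.min r 1.
have [e0 er e1] : [/\ 0 < e, e <= r & e <= 1].
  by split; rewrite ?lt_min ?r0 ?ltr01 ?ge_min ?lexx ?orbT.
have rx : region p (side_pt p i (1 - e)).
  by left; exists i, (1 - e) => //; apply/andP; split; clear -e0 e1; lra.
have ry : region p (side_pt p (ordS i) e).
  by left; exists (ordS i), e => //; apply/andP; split; clear -e0 e1; lra.
have h : 0 <= (1 / 2 : R) <= 1 by lra.
have := cp _ _ _ h rx ry.
have -> : (1 / 2) *: side_pt p i (1 - e) + (1 - 1 / 2) *: side_pt p (ordS i) e =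
    p (ordS i) + (e / 2) *: edge p (ordS i) - (e / 2) *: edge p i.
  by rewrite side_ptE /side_pt -/(edge p (ordS i)); apply: vec_eq; rewrite !coordE; field.
have e2 : 0 < e / 2 < r by clear -e0 er; lra.
have b := hr _ _ e2 e2.
have nb := beside_off b; case=> [bd|]; first exact: (nb bd).
case: os => _ _ out; apply: (out i).
apply: beside_scale b => //; by rewrite mulrN oppr_gt0 mulrC.
Qed.

End Reflex.

(** * The convex hull is spanned by the nonreflex vertices *)

Section Hull.
Variables (R : realType) (n : nat) (p : 'I_n -> R * R).
Hypothesis hp : simple_polygon p.
Implicit Types (i j k : 'I_n) (s t : R) (x y z a b d : R * R).

Lemma dot_perp x y : dot (perp x) y = cross x y.
Proof. by rewrite /dot /cross /perp /=; ring. Qed.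

Lemma cross_trans x y z : x != 0 -> cross x y = 0 -> cross x z = 0 -> cross y z = 0.
Proof.
move=> x0 /(cross0_colinear x0) -> /(cross0_colinear x0) ->.
by rewrite /cross !coordE; ring.
Qed.

(** A strictly extreme vertex turns the convex way, by [extreme_turn]. This is what removes the
    reflex vertices from all hull arguments. *)
Lemma nonreflex_max a : 'I_n -> exists2 i, i \notin reflex p &
  forall j, dot a (p j) <= dot a (p i).
Proof.
move=> i0; have [s os] := oriented_exists hp i0.
wlog a0 : a / a != 0.
  have [->|/[swap]/[apply]//] := eqVneq a 0 => /(_ (1, 0)) [|i ri _].
    by rewrite -dot_gt0 /dot /= mulr1 mulr0 addr0.
  by exists i => // j; rewrite /dot /= !mul0r.
have [i [imax [d dmax]]] := extreme_vertex hp i0 a0; exists i => //.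
elim/ord_predP: i dmax {imax} => i dmax.
by rewrite (reflexP hp i os) -leNgt ltW // (extreme_turn hp os dmax).
Qed.

Lemma region_support_nonreflex x d : 'I_n -> region p x ->
  exists2 j, j \notin reflex p & dot d x <= dot d (p j).
Proof.
move=> i0 /(region_support i0) /(_ d) [j xj].
have [i ri imax] := nonreflex_max d i0.
by exists i => //; exact: le_trans (imax j).
Qed.

(** If they were on one line, the maxima of both normals to it would squeeze all vertices onto the
    line; but the sides at a strictly extreme vertex are not parallel. *)
Lemma nonreflex_noncollinear x y : 'I_n -> x != y ->
  exists2 k, k \notin reflex p & orient x y (p k) != 0.
Proof.
move=> i0 xy; apply: contrapT => no.
have z k : k \notin reflex p -> cross (y - x) (p k - x) = 0.
  by move=> rk; apply/eqP/negPn/negP => h; apply: no; exists k.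
have v0 : y - x != 0 by rewrite subr_eq0 eq_sym.
have all0 j : cross (y - x) (p j - x) = 0.
  have [i /z iz imax] := nonreflex_max (perp (y - x)) i0.
  have [k /z kz kmin] := nonreflex_max (- perp (y - x)) i0.
  move: (imax j) (kmin j) iz kz; rewrite !dotNl !dot_perp /cross !coordE; lra.
have [i [_ [d dmax]]] := extreme_vertex hp i0 v0.
elim/ord_predP: i dmax => i dmax.
have [/negP c0 _] := extreme_beside hp dmax; apply: c0; apply/eqP.
have e0 j : cross (y - x) (edge p j) = 0.
  by have := all0 j; have := all0 (ordS j); rewrite /edge /cross !coordE; lra.
exact: cross_trans v0 (e0 _) (e0 _).
Qed.

(** The region is then the whole hull. A hull point off the boundary is strictly left of every side,
    so the segment joining it to a point close to the inner flank of a side avoids the boundary. *)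
Lemma convex_position s : oriented p s ->
  (forall i j, 0 <= s * cross (edge p i) (p j - p i)) -> 'I_n -> convex_polygon p.
Proof.
move=> os left i0; have s0 := oriented_neq0 os.
pose hull x := forall d, exists j, dot d x <= dot d (p j).
suff hullP x : hull x -> region p x.
  apply/convex_polygonP => x y t /andP[t0 t1] rx ry; apply: hullP => d.
  have [j xj] := region_support i0 rx d; have [k yk] := region_support i0 ry d.
  have [le|/ltW le] := leP (dot d (p j)) (dot d (p k)).
    exists k; rewrite dotD !dotZ; clear -t0 t1 xj yk le; nra.
  by exists j; rewrite dotD !dotZ; clear -t0 t1 xj yk le; nra.
move=> hx; have [bx|nbx] := pselect (boundary p x); first by left.
right.
(* When [x] is on the face of the hull where [a] is minimal, some vertex of this face is weakly
   ahead of [x] in direction [t]; otherwise [- a] tilted towards [t] would separate [x] from all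
   vertices. *)
have face (a t : R * R) : (forall j, 0 <= dot a (p j - x)) ->
    exists j, dot a (p j - x) = 0 /\ 0 <= dot t (p j - x).
  move=> pos; apply: contrapT => no.
  have [|d dneg] := perturb_direction (v := fun j => p j - x) (P := xpredT) (a := - a) (b := t).
    move=> j _; rewrite dotNl.
    have := pos j; rewrite le_eqVlt => /orP[/eqP e|gt]; last by left; rewrite oppr_lt0.
    right; rewrite -e oppr0; split=> //; rewrite ltNge; apply/negP => h; apply: no; exists j.
    by rewrite -e.
  have [j hj] := hx d; have := dneg j isT.
  by rewrite dotB ltNge subr_ge0 hj.
have strict i : 0 < s * cross (edge p i) (x - p i).
  set t := edge p i; pose a := s *: perp t.
  have aE z : dot a z = s * cross t z by rewrite dotZl dot_perp.
  have tt : 0 < dot t t by rewrite dot_gt0 edge_neq0.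
  rewrite lt_neqAle -aE; apply/andP; split; last first.
    have [j] := hx (- a); rewrite !dotNl lerN2 => h; rewrite dotB.
    by have := left i j; rewrite -/t -aE dotB; lra.
  apply/eqP => /esym xi.
  have pos j : 0 <= dot a (p j - x).
    by have := left i j; rewrite -/t -aE !dotB; move: xi; rewrite dotB; lra.
  have online z : dot a z = 0 -> z = (dot t z / dot t t) *: t.
    rewrite aE => /eqP; rewrite mulf_eq0 (negbTE s0) /= => /eqP.
    by apply: cross0_colinear; rewrite -dot_gt0.
  have [q1 [on1 t1]] := face a t pos.
  have [q2 [on2 t2]] := face a (- t) pos.
  (* Starting from [q2], each next vertex is again on the line of [t] and behind [x]: leaving the
     line would put [q1] on the wrong side of that edge, and passing [x] would put [x] on the
     boundary. This contradicts the position of [q1]. *)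
  have neg j : dot a (p j - x) = 0 /\ dot t (p j - x) < 0.
    apply: (@ordS_ind _ (fun j => dot a (p j - x) = 0 /\ dot t (p j - x) < 0) q2).
      split=> //; rewrite lt_neqAle; move: t2; rewrite dotNl oppr_ge0 => ->; rewrite andbT.
      apply/eqP => z; apply: nbx; exists q2, 0; first by rewrite lexx ler01.
      have := online _ on2; rewrite z mul0r scale0r => /eqP; rewrite subr_eq0 => /eqP <-.
      by rewrite side_pt0.
    move=> {j} j [onj tj].
    have onS : dot a (p (ordS j) - x) = 0.
      apply/eqP; rewrite eq_le pos andbT leNgt; apply/negP => gt.
      have e0 : 0 < dot a (edge p j) by move: gt onj; rewrite /edge !dotB; lra.
      have on12 : dot a (p q1 - p j) = 0 by move: on1 onj; rewrite !dotB; lra.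
      have t12 : 0 < dot t (p q1 - p j) by move: t1 tj; rewrite !dotB; lra.
      have := left j q1; rewrite (online _ on12) leNgt => /negP; apply.
      have -> : s * cross (edge p j) ((dot t (p q1 - p j) / dot t t) *: t) =
         - (dot t (p q1 - p j) / dot t t * dot a (edge p j)).
        by rewrite aE /cross !coordE; ring.
      by rewrite oppr_lt0 mulr_gt0 // divr_gt0.
    split=> //; rewrite ltNge; apply/negP => tS; apply: nbx.
    set u := dot t (p j - x) in tj *; set w := dot t (p (ordS j) - x) in tS *.
    have uw : 0 < w - u by lra.
    exists j, (- u / (w - u)).
      by apply/andP; split; rewrite ?ler_pdivlMr ?ler_pdivrMr //; lra.
    have e1 := online _ onj; have e2 := online _ onS; rewrite -/u in e1; rewrite -/w in e2.
    apply/esym/eqP; rewrite -subr_eq0; apply/eqP.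
    have -> : side_pt p j (- u / (w - u)) - x =
      (p j - x) + (- u / (w - u)) *: ((p (ordS j) - x) - (p j - x)).
      by rewrite /side_pt; apply: vec_eq; rewrite !coordE; ring.
    by rewrite e1 e2; apply: vec_eq; rewrite !coordE /=; field; rewrite !gt_eqF.
  by have [_] := neg q1; rewrite ltNge t1.
(* Moving slightly from the middle of side [i0] towards a vertex off its line gives the target [l],
   both on the inner flank and weakly left of every side. *)
have [k _ hk] : exists2 k, k \notin reflex p & orient (p i0) (p (ordS i0)) (p k) != 0.
  by apply: nonreflex_noncollinear => //; have := edge_neq0 hp i0; rewrite /edge subr_eq0 eq_sym.
have sb : 0 < s * cross (edge p i0) (p k - mid p i0).
  have -> : s * cross (edge p i0) (p k - mid p i0) = s * cross (edge p i0) (p k - p i0).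
    by rewrite /mid /side_pt -/(edge p i0) /cross !coordE; ring.
  by rewrite lt_neqAle left andbT eq_sym mulf_neq0.
have h := beside_near_mid hp sb.
near (0 : R)^'+ => e; have be : beside p s i0 (mid p i0 + e *: (p k - mid p i0)) by near: e.
have e0 : 0 < e by near: e; exact: nbhs_right_gt.
have e1 : e < 1 by near: e; exact: nbhs_right_lt.
set l := _ + _ in be.
have ll i : 0 <= s * cross (edge p i) (l - p i).
  have -> : s * cross (edge p i) (l - p i) =
     (1 - e) * (1 / 2 * (s * cross (edge p i) (p i0 - p i)) +
                1 / 2 * (s * cross (edge p i) (p (ordS i0) - p i))) +
     e * (s * cross (edge p i) (p k - p i)).
    by rewrite /l /mid /side_pt /cross !coordE; field.
  have e1' : 0 <= 1 - e by rewrite subr_ge0 ltW.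
  have half : 0 <= 1 / 2 :> R by rewrite divr_ge0.
  apply: addr_ge0; last by rewrite mulr_ge0 ?left // ltW.
  by apply: mulr_ge0 => //; apply: addr_ge0; apply: mulr_ge0.
have xl : reach p x l.
  apply: segment_reach => t t01; have [->|tn1] := eqVneq t 1.
    by rewrite scale1r subrKC; exact: beside_off be.
  move=> [j [c c01 ec]]; have : s * cross (edge p j) (x + t *: (l - x) - p j) = 0.
    by rewrite ec /side_pt -/(edge p j) /cross !coordE; ring.
  have -> : s * cross (edge p j) (x + t *: (l - x) - p j) =
    (1 - t) * (s * cross (edge p j) (x - p j)) + t * (s * cross (edge p j) (l - p j)).
    by rewrite /cross !coordE; ring.
  apply/eqP; rewrite gt_eqF // ltr_wpDr //; first by rewrite mulr_ge0 //; case/andP: t01.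
  by rewrite mulr_gt0 // subr_gt0 lt_neqAle tn1; case/andP: t01.
by case: os => _ ins _; apply: reach_inside (reach_sym xl) (ins i0 l be).
Unshelve. all: by end_near. Qed.

End Hull.

(** * Signed areas: crossing segments and sums of two angles *)

Section Points.
Variable R : realType.
Implicit Types (a b c d e i j k l m u v w : R * R) (s t : R).

Lemma orient_rot a b c : orient a b c = orient b c a.
Proof. by rewrite /orient /cross !coordE; ring. Qed.

Lemma orient_swap a b c : orient b a c = - orient a b c.
Proof. by rewrite /orient /cross !coordE; ring. Qed.

Lemma orient_edges a b c : orient a b c = cross (b - a) (c - b).
Proof. by rewrite /orient /cross !coordE; ring. Qed.

(** Both parameters are ratios of signed areas over the same denominator [w], which is a difference
    of signed areas in two ways. *)
Lemma segments_meet s a b c d :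
    0 <= s * orient a b c -> s * orient a b d <= 0 ->
    s * orient c d a <= 0 -> 0 <= s * orient c d b ->
    s * orient a b d < s * orient a b c ->
  exists t t' : R, [/\ 0 <= t <= 1, 0 <= t' <= 1 &
    a + t *: (b - a) = c + t' *: (d - c)].
Proof.
move=> h1 h2 h3 h4 lt.
set w := s * orient a b c - s * orient a b d.
have w0 : 0 < w by rewrite /w subr_gt0.
have s0 : s != 0 by apply/eqP => e; move: lt; rewrite e !mul0r ltxx.
have wE : w = s * orient c d b - s * orient c d a.
  by rewrite /w /orient /cross !coordE; ring.
have wX : orient a b c - orient a b d != 0.
  by move: (lt0r_neq0 w0); rewrite /w -mulrBr mulf_eq0 negb_or => /andP[].
exists (- (s * orient c d a) / w), (s * orient a b c / w); split.
- by apply/andP; split; rewrite ?ler_pdivlMr ?ler_pdivrMr //; lra.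
- by apply/andP; split; rewrite ?ler_pdivlMr ?ler_pdivrMr // /w; lra.
- have -> : - (s * orient c d a) / w = - orient c d a / (orient a b c - orient a b d).
    by rewrite /w -mulrBr; field; rewrite ?s0 ?wX.
  have -> : s * orient a b c / w = orient a b c / (orient a b c - orient a b d).
    by rewrite /w -mulrBr; field; rewrite ?s0 ?wX.
  by move: wX; rewrite /orient /cross !coordE => wX; apply: vec_eq; rewrite !coordE; field.
Qed.

(* Otherwise the closed line would be a pentagram, the sides [bc] and [ea]
   crossing each other. *)
Lemma five_points_convex s a b c d e :
    0 <= s * orient a b c -> 0 <= s * orient b c d -> 0 <= s * orient c d e ->
    0 <= s * orient d e a -> 0 <= s * orient e a b ->
    (orient a b c = 0 -> exists2 t : R, 0 < t & c - b = t *: (b - a)) ->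
    (forall t t' : R, 0 <= t <= 1 -> 0 <= t' <= 1 -> a + t *: (b - a) <> c + t' *: (d - c)) ->
    (forall t t' : R, 0 <= t <= 1 -> 0 <= t' <= 1 -> a + t *: (b - a) <> e + t' *: (d - e)) ->
    (forall t t' : R, 0 <= t <= 1 -> 0 <= t' <= 1 -> b + t *: (c - b) <> a + t' *: (e - a)) ->
  0 <= s * orient a b d.
Proof.
move=> abc bcd cde dea eab al n1 n2 n3; rewrite leNgt; apply/negP => abd.
(* If this failed, the segments [ab] and [cd] would meet; the next sign likewise rules out a meeting
   of [ab] and [ed]. *)
have acd : 0 < s * orient c d a.
  rewrite ltNge; apply/negP => le.
  have [||||| t [t' [t0 t1 eq]]] := @segments_meet s a b c d => //; first exact: ltW.
  - by rewrite orient_rot orient_rot.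
  - exact: lt_le_trans abc.
  - exact: n1 t0 t1 eq.
have bde : 0 < s * orient b d e.
  rewrite ltNge; apply/negP => le.
  have [||||| t [t' [t0 t1 eq]]] := @segments_meet s a b e d => //; try exact: ltW.
  - by rewrite -orient_rot.
  - by rewrite orient_swap mulrN oppr_le0.
  - by rewrite orient_swap mulrN oppr_ge0 -orient_rot.
  - by apply: lt_le_trans abd _; rewrite -orient_rot.
  - exact: n2 t0 t1 eq.
have bce : s * orient b c e <= 0.
  (* A Grassmann-Pluecker relation between signed areas, as is the one used next for [a], [c],
     [e]. *)
  have E : (s * orient a b d) * (s * orient b c e) =
     (s * orient a b c) * (s * orient b d e) + (s * orient e a b) * (s * orient b c d).
    by rewrite /orient /cross !coordE; ring.
  rewrite -(nmulr_rge0 _ abd) E addr_ge0 // mulr_ge0 //; exact: ltW.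
have ace : s * orient a c e <= 0.
  have E : (s * orient a b d) * (s * orient a c e) =
     (s * orient a b c) * (s * orient d e a) + (s * orient e a b) * (s * orient c d a).
    by rewrite /orient /cross !coordE; ring.
  rewrite -(nmulr_rge0 _ abd) E addr_ge0 // mulr_ge0 //; exact: ltW.
have s0 : s != 0 by apply/eqP => z; move: abd; rewrite z mul0r ltxx.
have abc0 : 0 < s * orient a b c.
  rewrite lt_neqAle abc andbT eq_sym mulf_neq0 //; apply/eqP => /al [t t0 cb].
  have : s * orient b c d = t * (s * orient a b d).
    by rewrite /orient cb /cross !coordE; ring.
  by move=> E; move: bcd; rewrite E leNgt pmulr_rlt0 ?abd.
have [||||| t [t' [t0 t1 eq]]] := @segments_meet s b c a e => //.
- by rewrite -orient_rot.
- by rewrite orient_swap mulrN oppr_le0.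
- have -> : orient a e c = - orient a c e by rewrite /orient /cross !coordE; ring.
  by rewrite mulrN oppr_ge0.
- by apply: le_lt_trans bce _; rewrite -orient_rot.
- exact: n3 t0 t1 eq.
Qed.

(** The sum exceeds [pi] when the rays from [i] to [k] and from [j] to [l] spread apart, that is,
    when [s * cross (k - i) (l - j)] is positive. The identity [E] derives this sign from the
    position of [i] and [j] relative to the lines [mk] and [lm]. *)
Lemma adjacent_angles s k i j l m : s = 1 \/ s = - 1 ->
    s * orient k i j < 0 -> s * orient i j l < 0 ->
    0 <= s * orient m k i -> 0 <= s * orient l m j -> 0 <= s * orient i j m ->
  pi < angle (j - i) (k - i) + angle (l - j) (i - j).
Proof.
move=> s1 kij ijl mki lmj ijm.
have ss : s * s = 1 by case: s1 => ->; rewrite ?mulr1 // mulrNN mulr1.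
have E : (s * orient i j m) * (s * cross (k - i) (l - j)) =
   (s * orient k i j) * (s * orient i j l) - (s * orient i j l) * (s * orient m k i)
   - (s * orient k i j) * (s * orient l m j).
  by rewrite /orient /cross !coordE; ring.
have uw : 0 < s * cross (k - i) (l - j).
  suff : 0 < (s * orient i j m) * (s * cross (k - i) (l - j)).
    by move: ijm; rewrite le_eqVlt => /orP[/eqP <-|gt]; rewrite ?mul0r ?ltxx // pmulr_rgt0.
  have p1 : 0 < (s * orient k i j) * (s * orient i j l) by rewrite nmulr_rgt0.
  have p2 : (s * orient i j l) * (s * orient m k i) <= 0 by rewrite nmulr_rle0.
  have p3 : (s * orient k i j) * (s * orient l m j) <= 0 by rewrite nmulr_rle0.
  by rewrite E; clear -p1 p2 p3; lra.
have e1 : cross (j - i) (k - i) = orient k i j by rewrite /orient /cross !coordE; ring.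
have e2 : cross (l - j) (i - j) = orient i j l by rewrite /orient /cross !coordE; ring.
have ij : 0 < dot (j - i) (j - i).
  rewrite dot_gt0; apply/eqP => z; move: kij; rewrite -e1 z /cross /= !mul0r subrr mulr0.
  by rewrite ltxx.
apply: (@angle_sum_gt_pi _ (- s)).
- by case: s1 => ->; [right | left; rewrite opprK].
- by rewrite e1 mulNr oppr_gt0.
- by rewrite e2 mulNr oppr_gt0.
have -> : dot (j - i) (k - i) * (- s * cross (l - j) (i - j)) +
    - s * cross (j - i) (k - i) * dot (l - j) (i - j) =
    - (dot (j - i) (j - i) * (s * cross (k - i) (l - j))).
  by rewrite /dot /cross !coordE; ring.
by rewrite oppr_lt0 mulr_gt0.
Qed.

(* The weights place the reflex vertices inside the triangle [l, l + u, l + v],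
   the first one on the side of [l + u] as seen from [l]. *)
Lemma nested_dots_lt0 u v (a1 g1 a2 g2 : R) : cross u v != 0 ->
    0 <= a1 -> 0 < g1 -> 0 < a2 -> g1 * a2 <= a1 * g2 -> a1 + g1 <= 1 -> a2 + g2 <= 1 ->
    (a1 != a2) || (g1 != g2) ->
  a2 * dot (a1 *: u + g1 *: v) (g1 *: v - (1 - a1) *: u) +
  g1 * dot ((1 - g2) *: v - a2 *: u) (- (a2 *: u + g2 *: v)) < 0.
Proof.
move=> uv0 a1ge0 g1p a2p det s1 s2 ne.
have uu : 0 < dot u u by rewrite dot_gt0; case: (cross_neq0 uv0).
have vv : 0 < dot v v by rewrite dot_gt0; case: (cross_neq0 uv0).
have gram : dot u v ^+ 2 < dot u u * dot v v.
  by rewrite -lagrange_identity ltrDl exprn_even_gt0.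
have [a1p g2p] : 0 < a1 /\ 0 < g2.
  have ag : 0 < a1 * g2 by apply: lt_le_trans det; rewrite mulr_gt0.
  have a1p : 0 < a1.
    by rewrite lt_neqAle a1ge0 andbT; apply/eqP => z; move: ag; rewrite -z mul0r ltxx.
  by split=> //; move: ag; rewrite pmulr_rgt0.
have det0 : 0 <= a1 * g2 - g1 * a2 by rewrite subr_ge0.
have s10 : 0 <= 1 - (a1 + g1) by rewrite subr_ge0.
have s20 : 0 <= 1 - (a2 + g2) by rewrite subr_ge0.
have [a2n g1n g2n] : [/\ 0 <= a2, 0 <= g1 & 0 <= g2] by split; exact: ltW.
pose P := a2 * (a1 * (1 - a1) - g1 * a2); pose Q := g1 * (g2 * (1 - g2) - a2 * g1).
pose D := a1 + g2 - 1.
have -> : a2 * dot (a1 *: u + g1 *: v) (g1 *: v - (1 - a1) *: u) +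
  g1 * dot ((1 - g2) *: v - a2 *: u) (- (a2 *: u + g2 *: v)) =
  - (P * dot u u - 2 * (a2 * g1 * D) * dot u v + Q * dot v v).
  by rewrite /P /Q /D /dot !coordE; ring.
rewrite oppr_lt0; case: (ltgtP D 0) => [D0|D0|D0].
- have hP : a2 * a1 * - D <= P.
    rewrite -subr_ge0 /P /D.
    have -> : a2 * (a1 * (1 - a1) - g1 * a2) - a2 * a1 * - (a1 + g2 - 1) =
      a2 * (a1 * g2 - g1 * a2) by ring.
    by rewrite mulr_ge0.
  have hQ : g1 * g2 * - D <= Q.
    rewrite -subr_ge0 /Q /D.
    have -> : g1 * (g2 * (1 - g2) - a2 * g1) - g1 * g2 * - (a1 + g2 - 1) =
      g1 * (a1 * g2 - g1 * a2) by ring.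
    by rewrite mulr_ge0.
  suff pos : 0 < a2 * a1 * dot u u + 2 * (a2 * g1) * dot u v + g1 * g2 * dot v v.
    have h1 : a2 * a1 * - D * dot u u <= P * dot u u by rewrite ler_pM2r.
    have h2 : g1 * g2 * - D * dot v v <= Q * dot v v by rewrite ler_pM2r.
    apply: lt_le_trans (_ : - D * (a2 * a1 * dot u u + 2 * (a2 * g1) * dot u v +
      g1 * g2 * dot v v) <= _); first by rewrite mulr_gt0 // oppr_gt0.
    by clear -h1 h2; lra.
  have aa : 0 < a2 * a1 by rewrite mulr_gt0.
  rewrite -(pmulr_rgt0 _ aa).
  have -> : a2 * a1 * (a2 * a1 * dot u u + 2 * (a2 * g1) * dot u v + g1 * g2 * dot v v) =
     dot (a2 *: (a1 *: u + g1 *: v)) (a2 *: (a1 *: u + g1 *: v)) +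
     a2 * g1 * (a1 * g2 - g1 * a2) * dot v v by rewrite /dot !coordE; ring.
  apply: ltr_pwDl; last by rewrite !mulr_ge0 ?subr_ge0 // ltW.
  rewrite dot_gt0; apply/eqP => z.
  have : cross (a2 *: (a1 *: u + g1 *: v)) v = a2 * a1 * cross u v.
    by rewrite /cross !coordE; ring.
  rewrite z /cross /= !mul0r subrr => /esym/eqP.
  by apply/negP; rewrite mulf_neq0 // gt_eqF.
- have hP : a2 * g1 * D <= P.
    rewrite -subr_ge0 /P /D.
    have -> : a2 * (a1 * (1 - a1) - g1 * a2) - a2 * g1 * (a1 + g2 - 1) =
      a2 * (a1 * (1 - (a1 + g1)) + g1 * (1 - (a2 + g2))) by ring.
    by rewrite mulr_ge0 ?addr_ge0 ?mulr_ge0.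
  have hQ : a2 * g1 * D <= Q.
    rewrite -subr_ge0 /Q /D.
    have -> : g1 * (g2 * (1 - g2) - a2 * g1) - a2 * g1 * (a1 + g2 - 1) =
      g1 * (g2 * (1 - (a2 + g2)) + a2 * (1 - (a1 + g1))) by ring.
    by rewrite mulr_ge0 ?addr_ge0 ?mulr_ge0.
  have h1 : a2 * g1 * D * dot u u <= P * dot u u by rewrite ler_pM2r.
  have h2 : a2 * g1 * D * dot v v <= Q * dot v v by rewrite ler_pM2r.
  have uv : 0 < dot (u - v) (u - v).
    rewrite dot_gt0 subr_eq0; apply/eqP => z; move: uv0; rewrite z /cross.
    by rewrite mulrC subrr eqxx.
  have : 0 < a2 * g1 * D * dot (u - v) (u - v) by rewrite !mulr_gt0.
  have -> : dot (u - v) (u - v) = dot u u - 2 * dot u v + dot v v.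
    by rewrite /dot !coordE; ring.
  by clear -h1 h2; lra.
- have g2E : g2 = 1 - a1 by move: D0; rewrite /D; clear; lra.
  have a21 : a2 <= a1 by move: s2; rewrite g2E; clear; lra.
  have g12 : g1 <= 1 - a1 by clear -s1; lra.
  have a1l : 0 < 1 - a1 by rewrite -g2E.
  have strict : g1 * a2 < a1 * (1 - a1).
    move: ne; rewrite g2E; case: (ltgtP a2 a1) a21 => // [lt _ _|-> _].
      apply: le_lt_trans (_ : (1 - a1) * a2 < _); first by rewrite ler_pM2r.
      by rewrite mulrC ltr_pM2r.
    rewrite ?eqxx /= => ne; rewrite [X in _ < X]mulrC ltr_pM2r //.
    by rewrite lt_neqAle ne.
  rewrite D0 mulr0 mulr0 mul0r subr0 addr_gt0 // mulr_gt0 //.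
    by rewrite /P mulr_gt0 // subr_gt0.
  by rewrite /Q mulr_gt0 // subr_gt0 g2E mulrC [X in _ < X]mulrC opprB addrCA subrr addr0.
Qed.

(** In barycentric coordinates for the triangle [klm], with origin [l], the two cross products are
    [T * g1] and [T * a2], the sign of [orient i l j] is the determinant condition, and the
    numerator of the sine becomes [T] times the expression of [nested_dots_lt0]. *)
Lemma nonadjacent_angles s k i l j m : s = 1 \/ s = - 1 ->
    0 < s * orient k l m ->
    s * orient k i l < 0 -> s * orient l j m < 0 ->
    0 <= s * orient l m i ->
    0 <= s * orient m k i -> 0 <= s * orient m k j -> 0 <= s * orient i l j ->
    i != j ->
  pi < angle (l - i) (k - i) + angle (m - j) (l - j).
Proof.
move=> s1 klm kil ljm lmi mki mkj ilj ij.
have ss : s * s = 1 by case: s1 => ->; rewrite ?mulr1 // mulrNN mulr1.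
set T := s * orient k l m in klm *.
have TX : T != 0 by rewrite gt_eqF.
pose a1 := s * orient l m i / T; pose g1 := s * orient k l i / T.
pose a2 := s * orient l m j / T; pose g2 := s * orient k l j / T.
have bary x : x = l + (s * orient l m x / T) *: (k - l) + (s * orient k l x / T) *: (m - l).
  have T' : orient k l m != 0 by move: TX; rewrite /T mulf_eq0 negb_or => /andP[].
  have s0 : s != 0 by move: TX; rewrite /T mulf_eq0 negb_or => /andP[].
  have E y : s * y / T = y / orient k l m by rewrite /T; field; rewrite ?s0 ?T'.
  rewrite !E; move: T'; rewrite /orient /cross !coordE => T'.
  by apply: vec_eq; rewrite !coordE; field.
have iE : i = l + a1 *: (k - l) + g1 *: (m - l) := bary i.
have jE : j = l + a2 *: (k - l) + g2 *: (m - l) := bary j.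
have sumE x : s * orient l m x / T + s * orient k l x / T = 1 - s * orient m k x / T.
  rewrite -[1](divff TX) -mulrDl -mulrBl; congr (_ / _).
  by rewrite /T /orient /cross !coordE; ring.
set X := cross (k - l) (m - l).
have XE : s * X = - T by rewrite /X /T /orient /cross !coordE; ring.
have X0 : X != 0.
  by apply/eqP => z; move: XE; rewrite z mulr0 => /eqP; rewrite eq_sym oppr_eq0 (negbTE TX).
have g1p : 0 < g1.
  rewrite divr_gt0 //; have -> : orient k l i = - orient k i l.
    by rewrite /orient /cross !coordE; ring.
  by rewrite mulrN oppr_gt0.
have a2p : 0 < a2.
  rewrite divr_gt0 //; have -> : orient l m j = - orient l j m.
    by rewrite /orient /cross !coordE; ring.
  by rewrite mulrN oppr_gt0.
have det : g1 * a2 <= a1 * g2.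
  rewrite -subr_ge0.
  have : s * orient i l j = T * (a1 * g2 - g1 * a2).
    rewrite -[T]opprK -XE /X {1}iE {1}jE /orient /cross !coordE; ring.
  by move=> E; move: ilj; rewrite E pmulr_rge0.
have s1' : a1 + g1 <= 1 by rewrite sumE gerBl divr_ge0 // ltW.
have s2' : a2 + g2 <= 1 by rewrite sumE gerBl divr_ge0 // ltW.
have ne : (a1 != a2) || (g1 != g2).
  rewrite -negb_and; apply/negP => /andP[/eqP e1 /eqP e2].
  by case/eqP: ij; rewrite iE jE e1 e2.
have c1 : - s * cross (l - i) (k - i) = T * g1.
  by rewrite -[T]opprK -XE /X {1 2}iE /cross !coordE; ring.
have c2 : - s * cross (m - j) (l - j) = T * a2.
  by rewrite -[T]opprK -XE /X {1 2}jE /cross !coordE; ring.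
apply: (@angle_sum_gt_pi _ (- s)).
- by case: s1 => ->; [right | left; rewrite opprK].
- by rewrite c1 mulr_gt0.
- by rewrite c2 mulr_gt0.
have a10 : 0 <= a1 by rewrite divr_ge0 // ltW.
have main := nested_dots_lt0 X0 a10 g1p a2p det s1' s2' ne.
rewrite c1 c2.
have -> : dot (l - i) (k - i) * (T * a2) + T * g1 * dot (m - j) (l - j) =
  T * (a2 * dot (a1 *: (k - l) + g1 *: (m - l)) (g1 *: (m - l) - (1 - a1) *: (k - l)) +
  g1 * dot ((1 - g2) *: (m - l) - a2 *: (k - l)) (- (a2 *: (k - l) + g2 *: (m - l)))).
  by rewrite {1 2}iE {1 2}jE /dot !coordE; ring.
by rewrite pmulr_rlt0.
Qed.

End Points.

(** * Area bounds by integration of sections *)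

Section Area.
Variable R : realType.
Implicit Types (a b c q : R * R) (X : set (R * R)) (s t : R).

Let mu := @lebesgue_measure R.

(** The Lebesgue measure unfolds to an outer measure, monotone on arbitrary sets; sections of a
    region can thus be compared directly with segments. *)
Lemma le_lebesgue_measure (A B : set R) : A `<=` B -> (mu A <= mu B)%E.
Proof.
move=> AB; rewrite /mu /lebesgue_measure /= /lebesgue_stieltjes_measure /=.
by rewrite /measure_extension /=; exact: le_outer_measure.
Qed.

Lemma lebesgue_segment_le (lo hi c : R) : 0 <= c -> hi - lo <= c ->
  (mu `[lo, hi] <= c%:E)%E.
Proof.
move=> c0 hc; rewrite /mu lebesgue_measure_itv /=; case: ifP => _.
  by rewrite -EFinB lee_fin.
by rewrite lee_fin.
Qed.

(* No measurability of X is assumed. *)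
Lemma product_measure_le X (g : R -> \bar R) :
  (forall x, mu (xsection X x) <= g x)%E ->
  ((lebesgue_measure \x lebesgue_measure) X <= \int[mu]_x g x)%E.
Proof.
move=> h; rewrite /product_measure1 /=.
have g0 x : (0 <= g x)%E by exact: le_trans (h x).
have m0 x : (0 <= mu (xsection X x))%E by exact: measure_ge0.
rewrite !ge0_integralTE //; apply: le_ereal_sup => _ [f /= fle <-].
by exists f => //= x; apply: le_trans (fle x) (h x).
Qed.

Lemma integral_affine (k z x0 x1 : R) : x0 <= x1 ->
  (\int[mu]_(x in `[x0, x1]) (k * (x - z))%:E =
   (k * ((x1 - z) ^+ 2 - (x0 - z) ^+ 2) / 2)%:E)%E.
Proof.
rewrite le_eqVlt => /orP[/eqP <-|lt].
  by rewrite set_itv1 integral_set1 subrr mulr0 mul0r.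
pose F (x : R) : R := k / 2 * ((x - z) * (x - z)).
have dF (x : R) : is_derive x 1 F (k * (x - z)).
  by rewrite /F; apply: is_derive_eq; rewrite /GRing.scale /=; field.
have cF : continuous F.
  by move=> x; apply: differentiable_continuous; apply/derivable1_diffP.
rewrite (@continuous_FTC2 _ (fun x => k * (x - z)) F) //.
- by rewrite -EFinB /F; congr (_%:E); field.
- apply: continuous_subspaceT => x; apply: cvgM; first exact: cvg_cst.
  by apply: cvgB; [exact: cvg_id | exact: cvg_cst].
- split.
  + by move=> x _.
  + by apply: cvg_at_right_filter; exact: cF.
  + by apply: cvg_at_left_filter; exact: cF.
- by move=> x _; rewrite derive1E derive_val.
Qed.

Lemma lebesgue_between_le (A : set R) s (l u k : R) : s = 1 \/ s = - 1 ->
  (forall y, A y -> 0 <= s * (y - l) /\ 0 <= s * (u - y)) ->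
  0 <= k -> s * (u - l) <= k -> (mu A <= k%:E)%E.
Proof.
move=> s1 Alu k0 lu.
case: s1 Alu lu => -> Alu lu.
  apply: (@le_trans _ _ (mu `[l, u])); last by apply: lebesgue_segment_le; lra.
  apply: le_lebesgue_measure => y /Alu [h1 h2]; rewrite /= in_itv /=; apply/andP; split; lra.
apply: (@le_trans _ _ (mu `[u, l])); last by apply: lebesgue_segment_le; lra.
apply: le_lebesgue_measure => y /Alu [h1 h2]; rewrite /= in_itv /=; apply/andP; split; lra.
Qed.

Definition in_triangle s a b c q : Prop :=
  [/\ 0 <= s * orient a b q, 0 <= s * orient b c q & 0 <= s * orient c a q].

(** Cavalieri's principle: vertical sections have length at most [k1 * (x - a.1)] up to the abscissa
    of [b] and [k2 * (c.1 - x)] after it, and the integrals of these two affine functions add up to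
    the area. *)
Lemma triangle_area_sorted s a b c X : s = 1 \/ s = - 1 ->
    0 < s * orient a b c -> a.1 <= b.1 -> b.1 <= c.1 ->
    (forall q, X q -> in_triangle s a b c q) ->
  ((lebesgue_measure \x lebesgue_measure) X <= (s * orient a b c / 2)%:E)%E.
Proof.
move=> s1; set D := s * orient a b c => D0 ab bc Xabc.
have DE : D = s * ((b.1 - a.1) * (c.2 - a.2) - (b.2 - a.2) * (c.1 - a.1)).
  by rewrite /D /orient /cross !coordE.
have ac : a.1 < c.1.
  rewrite lt_neqAle (le_trans ab bc) andbT; apply/eqP => e.
  have e' : b.1 = a.1 by apply/eqP; rewrite eq_le ab e bc.
  by move: D0; rewrite DE e' -e !subrr mul0r mulr0 subrr mulr0 ltxx.
pose m := (c.2 - a.2) / (c.1 - a.1).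
have mE : m * (c.1 - a.1) = c.2 - a.2 by rewrite /m divfK // subr_eq0 gt_eqF.
(* If [b] has the abscissa of [a] or of [c], the corresponding slope is 0 by the convention for
   division by zero, and that piece contributes nothing. *)
pose k1 := D / ((b.1 - a.1) * (c.1 - a.1)).
pose k2 := D / ((c.1 - b.1) * (c.1 - a.1)).
have acn := ltW ac; have D0n := ltW D0.
have k10 : 0 <= k1 by apply: divr_ge0 => //; apply: mulr_ge0; rewrite subr_ge0.
have k20 : 0 <= k2 by apply: divr_ge0 => //; apply: mulr_ge0; rewrite subr_ge0.
pose g1 := (fun x : R => (k1 * (x - a.1))%:E) \_ `[a.1, b.1].
pose g2 := (fun x : R => (- k2 * (x - c.1))%:E) \_ `[b.1, c.1].
have g10 x : (0 <= g1 x)%E.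
  apply: erestrict_ge0 => y; rewrite /= in_itv /= => /andP[h1 h2].
  by rewrite lee_fin mulr_ge0 // subr_ge0.
have g20 x : (0 <= g2 x)%E.
  apply: erestrict_ge0 => y; rewrite /= in_itv /= => /andP[h1 h2].
  by rewrite lee_fin mulNr -mulrN mulr_ge0 // opprB subr_ge0.
have maff (k z : R) (A : set R) : measurable_fun A (EFin \o (fun x : R => k * (x - z))).
  apply/measurable_EFinP; apply: measurable_funM; first exact: measurable_cst.
  by apply: measurable_funB; [exact: measurable_id | exact: measurable_cst].
have mg1 : measurable_fun setT g1.
  exact: ((measurable_restrictT _ (measurable_itv _)).1 (maff _ _ _)).
have mg2 : measurable_fun setT g2.
  exact: ((measurable_restrictT _ (measurable_itv _)).1 (maff _ _ _)).
have -> : (s * orient a b c / 2)%:E = (\int[mu]_x (g1 x + g2 x))%E.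
  rewrite ge0_integralD // /g1 /g2 -!integral_mkcond !integral_affine //.
  rewrite -EFinD; congr (_%:E); rewrite -/D !subrr.
  have K1 : k1 * (b.1 - a.1) ^+ 2 = D * (b.1 - a.1) / (c.1 - a.1).
    rewrite /k1; have [->|ne] := eqVneq b.1 a.1; first by rewrite !subrr mulr0 mul0r expr0n /= !mulr0.
    by field; rewrite !subr_eq0 ne gt_eqF.
  have K2 : k2 * (b.1 - c.1) ^+ 2 = D * (c.1 - b.1) / (c.1 - a.1).
    rewrite /k2; have [->|ne] := eqVneq c.1 b.1; first by rewrite !subrr mulr0 mul0r expr0n /= !mulr0.
    by field; rewrite subr_eq0 gt_eqF // subr_eq0 ne.
  have -> : k1 * ((b.1 - a.1) ^+ 2 - 0 ^+ 2) / 2 + - k2 * (0 ^+ 2 - (b.1 - c.1) ^+ 2) / 2 =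
    (k1 * (b.1 - a.1) ^+ 2 + k2 * (b.1 - c.1) ^+ 2) / 2 by field.
  by rewrite K1 K2; field; rewrite subr_eq0 gt_eqF.
apply: product_measure_le => x.
have Xx y : xsection X x y -> in_triangle s a b c (x, y) by move=> /xsectionP; exact: Xabc.
have [xac|xac] := boolP (a.1 <= x <= c.1); last first.
  suff -> : xsection X x = set0 by rewrite /mu measure0 adde_ge0.
  apply/seteqP; split=> // y /Xx [h1 h2 h3]; case/negP: xac.
  have E1 : D * (x - a.1) = s * orient c a (x, y) * (b.1 - a.1) + s * orient a b (x, y) * (c.1 - a.1).
    by rewrite /D /orient /cross !coordE /=; ring.
  have E2 : D * (c.1 - x) = s * orient b c (x, y) * (c.1 - a.1) + s * orient c a (x, y) * (c.1 - b.1).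
    by rewrite /D /orient /cross !coordE /=; ring.
  apply/andP; split; rewrite -subr_ge0 -(pmulr_rge0 _ D0).
    by rewrite E1 addr_ge0 // mulr_ge0 // subr_ge0.
  by rewrite E2 addr_ge0 // mulr_ge0 // subr_ge0.
case/andP: xac => xa xc.
have [/andP[xb lab]|other] := boolP ((x <= b.1) && (a.1 < b.1)).
  apply: (@le_trans _ _ (g1 x)); last by rewrite leeDl.
  rewrite /g1 patchE ifT; last by rewrite inE /= in_itv /= xa xb.
  pose m1 := (b.2 - a.2) / (b.1 - a.1).
  have ne : b.1 - a.1 != 0 by rewrite subr_eq0 gt_eqF.
  have nc : c.1 - a.1 != 0 by rewrite subr_eq0 gt_eqF.
  have m1E : m1 * (b.1 - a.1) = b.2 - a.2 by rewrite /m1 divfK.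
  apply: (@lebesgue_between_le _ s (a.2 + m1 * (x - a.1)) (a.2 + m * (x - a.1))) => //.
  - move=> y /Xx [h1 _ h3]; split.
      have lab' : 0 < b.1 - a.1 by rewrite subr_gt0.
      rewrite -(pmulr_rge0 _ lab').
      suff -> : (b.1 - a.1) * (s * (y - (a.2 + m1 * (x - a.1)))) = s * orient a b (x, y) by [].
      transitivity (s * ((b.1 - a.1) * (y - a.2) - m1 * (b.1 - a.1) * (x - a.1))); first by ring.
      by rewrite m1E /orient /cross !coordE.
    have lac' : 0 < c.1 - a.1 by rewrite subr_gt0.
    rewrite -(pmulr_rge0 _ lac').
    suff -> : (c.1 - a.1) * (s * (a.2 + m * (x - a.1) - y)) = s * orient c a (x, y) by [].
    transitivity (s * (m * (c.1 - a.1) * (x - a.1) - (c.1 - a.1) * (y - a.2))); first by ring.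
    by rewrite mE /orient /cross !coordE /=; ring.
  - by rewrite mulr_ge0 // subr_ge0.
  - rewrite le_eqVlt; apply/orP; left; apply/eqP.
    rewrite /k1 DE /m1 /m; field.
    by rewrite ne nc.
have lbc : b.1 < c.1 /\ b.1 <= x.
  move: other; rewrite negb_and -ltNge -leNgt => /orP[lt|le].
    by split; [exact: lt_le_trans lt xc | exact: ltW].
  by split; [exact: le_lt_trans le ac | exact: le_trans le xa].
case: lbc => lbc bx.
apply: (@le_trans _ _ (g2 x)); last by rewrite leeDr.
rewrite /g2 patchE ifT; last by rewrite inE /= in_itv /= bx xc.
pose m2 := (c.2 - b.2) / (c.1 - b.1).
have ne : c.1 - b.1 != 0 by rewrite subr_eq0 gt_eqF.
have nc : c.1 - a.1 != 0 by rewrite subr_eq0 gt_eqF.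
have m2E : m2 * (c.1 - b.1) = c.2 - b.2 by rewrite /m2 divfK.
apply: (@lebesgue_between_le _ s (c.2 + m2 * (x - c.1)) (c.2 + m * (x - c.1))) => //.
- move=> y /Xx [_ h2 h3]; split.
    have lab' : 0 < c.1 - b.1 by rewrite subr_gt0.
    rewrite -(pmulr_rge0 _ lab').
    suff -> : (c.1 - b.1) * (s * (y - (c.2 + m2 * (x - c.1)))) = s * orient b c (x, y) by [].
    transitivity (s * ((c.1 - b.1) * (y - c.2) - m2 * (c.1 - b.1) * (x - c.1))); first by ring.
    by rewrite m2E /orient /cross !coordE /=; ring.
  have lac' : 0 < c.1 - a.1 by rewrite subr_gt0.
  rewrite -(pmulr_rge0 _ lac').
  suff -> : (c.1 - a.1) * (s * (c.2 + m * (x - c.1) - y)) = s * orient c a (x, y) by [].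
  transitivity (s * (m * (c.1 - a.1) * (x - c.1) - (c.1 - a.1) * (y - c.2))); first by ring.
  by rewrite mE /orient /cross !coordE /=; ring.
- by rewrite mulNr -mulrN mulr_ge0 // opprB subr_ge0.
- rewrite le_eqVlt; apply/orP; left; apply/eqP.
  rewrite /k2 DE /m2 /m; field.
  by rewrite ne nc.
Qed.

(** The vertices are sorted by abscissa: rotations preserve the orientation, and transpositions
    reverse it together with [s]. *)
Lemma triangle_area s a b c X : s = 1 \/ s = - 1 ->
    0 < s * orient a b c ->
    (forall q, X q -> in_triangle s a b c q) ->
  ((lebesgue_measure \x lebesgue_measure) X <= (s * orient a b c / 2)%:E)%E.
Proof.
have rotate a' b' c' q r : in_triangle r a' b' c' q -> in_triangle r b' c' a' q.
  by case.
have swap a' b' c' q r : in_triangle r a' b' c' q -> in_triangle (- r) b' a' c' q.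
  by case=> h1 h2 h3; split; rewrite mulNr -mulrN -orient_swap.
move=> s1 D0 XT.
have s2 : - s = 1 \/ - s = - 1 by case: s1 => ->; [right | left; rewrite opprK].
have H r x y z : r = 1 \/ r = - 1 -> r * orient x y z = s * orient a b c ->
    (forall q, X q -> in_triangle r x y z q) -> x.1 <= y.1 -> y.1 <= z.1 ->
    ((lebesgue_measure \x lebesgue_measure) X <= (s * orient a b c / 2)%:E)%E.
  move=> r1 E XT' xy yz; rewrite -E; apply: triangle_area_sorted => //.
  by rewrite E.
have E1 : s * orient b c a = s * orient a b c by rewrite -orient_rot.
have E2 : s * orient c a b = s * orient a b c by rewrite orient_rot.
have Es x y z : s * orient x y z = s * orient a b c -> - s * orient y x z = s * orient a b c.
  by rewrite mulNr -mulrN -orient_swap.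
have T1 q : X q -> in_triangle s b c a q by move=> /XT /rotate.
have T2 q : X q -> in_triangle s c a b q by move=> /T1 /rotate.
case: (leP a.1 b.1) => [ab|/ltW ba]; case: (leP b.1 c.1) => [bc|/ltW cb];
  case: (leP a.1 c.1) => [ac|/ltW ca].
- exact: (H s a b c).
- exact: (H s a b c).
- by apply: (H (- s) a c b) => //; [exact: Es | move=> q /T2 /swap].
- exact: (H s c a b).
- by apply: (H (- s) b a c) => //; [exact: Es | move=> q /XT /swap].
- exact: (H s b c a).
- by apply: (H (- s) c b a) => //; [exact: Es | move=> q /T1 /swap].
- by apply: (H (- s) c b a) => //; [exact: Es | move=> q /T1 /swap].
Qed.

End Area.

(** * Isoperimetric inequalities for three and four points *)

Ltac perm_signs h0 h1 h2 h3 h4 :=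
  first [ by move=> ?; rewrite !inE => /or4P[] /eqP ->; rewrite eqxx ?orbT
        | by clear -h0 h1 h2 h3 h4; rewrite ?mul1r ?mulN1r; lra ].

Section Isoperimetric.
Variable R : realType.
Implicit Types (a b c d q u v x y z : R * R) (X : set (R * R)) (s t : R).

Lemma dot_le_elen u v : dot u v <= elen u * elen v.
Proof.
apply: le_trans (ler_norm _) _.
rewrite -(@ler_pXn2r _ 2) ?nnegrE ?mulr_ge0 ?elen_ge0 // exprMn !sqr_elen.
by rewrite -lagrange_identity real_normK ?num_real // lerDl sqr_ge0.
Qed.

Lemma elenD u v : elen (u + v) <= elen u + elen v.
Proof.
rewrite -(@ler_pXn2r _ 2) ?nnegrE ?addr_ge0 ?elen_ge0 // sqrrD !sqr_elen.
have -> : dot (u + v) (u + v) = dot u u + 2 * dot u v + dot v v.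
  by rewrite /dot !coordE; ring.
by have := dot_le_elen u v; rewrite mulr2n; lra.
Qed.

Lemma elenD_lt u v : cross u v != 0 -> elen (u + v) < elen u + elen v.
Proof.
move=> c0; rewrite -(@ltr_pXn2r _ 2) ?nnegrE ?addr_ge0 ?elen_ge0 // sqrrD !sqr_elen.
have -> : dot (u + v) (u + v) = dot u u + 2 * dot u v + dot v v.
  by rewrite /dot !coordE; ring.
suff : dot u v < elen u * elen v by rewrite mulr2n; lra.
apply: le_lt_trans (ler_norm _) _.
rewrite -(@ltr_pXn2r _ 2) ?nnegrE ?mulr_ge0 ?elen_ge0 // exprMn !sqr_elen.
by rewrite -lagrange_identity real_normK ?num_real // ltrDl exprn_even_gt0.
Qed.

Lemma elenN u : elen (- u) = elen u.
Proof. by rewrite /elen /dot /= !mulrNN. Qed.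

Definition dist x y : R := elen (y - x).

Lemma distC x y : dist x y = dist y x.
Proof. by rewrite /dist -elenN opprB. Qed.

Lemma dist_triangle y x z : dist x z <= dist x y + dist y z.
Proof.
rewrite /dist; have -> : z - x = (y - x) + (z - y) by rewrite [RHS]addrC subrKA.
exact: elenD.
Qed.

Lemma dist_triangle_lt y x z : orient x y z != 0 -> dist x z < dist x y + dist y z.
Proof.
rewrite orient_edges => o; rewrite /dist.
have -> : z - x = (y - x) + (z - y) by rewrite [RHS]addrC subrKA.
exact: elenD_lt.
Qed.

(* Heron's formula and the arithmetic-geometric mean inequality. *)
Lemma cross_sqr_le u v :
  108 * cross u v ^+ 2 <= (elen u + elen v + elen (u + v)) ^+ 4.
Proof.
have h1 := elenD u v.
have h2 : elen v <= elen u + elen (u + v).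
  by have := elenD (- u) (u + v); rewrite addKr elenN.
have h3 : elen u <= elen v + elen (u + v).
  by have := elenD (- v) (u + v); rewrite [u + v]addrC addKr elenN addrC.
set A := elen u in h1 h2 h3 *; set B := elen v in h1 h2 h3 *.
set C := elen (u + v) in h1 h2 h3 *.
have E : 4 * cross u v ^+ 2 = (A + B + C) * ((A + B - C) * (C + A - B) * (C + B - A)).
  have AE : A ^+ 2 = dot u u := sqr_elen u.
  have BE : B ^+ 2 = dot v v := sqr_elen v.
  have CE : C ^+ 2 = dot u u + 2 * dot u v + dot v v.
    by rewrite /C sqr_elen /dot !coordE; ring.
  have -> : (A + B + C) * ((A + B - C) * (C + A - B) * (C + B - A)) =
      4 * (A ^+ 2 * B ^+ 2) - (C ^+ 2 - A ^+ 2 - B ^+ 2) ^+ 2 by ring.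
  by rewrite AE BE CE -lagrange_identity; ring.
have [x0 y0 z0] : [/\ 0 <= A + B - C, 0 <= C + A - B & 0 <= C + B - A] by split; lra.
have amgm (x y z : R) : 0 <= x -> 0 <= y -> 0 <= z -> 27 * (x * y * z) <= (x + y + z) ^+ 3.
  move=> hx hy hz; rewrite -subr_ge0.
  have -> : (x + y + z) ^+ 3 - 27 * (x * y * z) =
     (x + y + z) / 2 * ((x - y) ^+ 2 + (y - z) ^+ 2 + (z - x) ^+ 2) +
     3 * (x * (y - z) ^+ 2 + y * (z - x) ^+ 2 + z * (x - y) ^+ 2) by field.
  have sq (r r' : R) : 0 <= (r - r') ^+ 2 by exact: sqr_ge0.
  have xyz : 0 <= x + y + z by rewrite !addr_ge0.
  apply: addr_ge0; first by apply: mulr_ge0; [rewrite divr_ge0 | rewrite !addr_ge0].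
  by apply: mulr_ge0 => //; apply: addr_ge0; [apply: addr_ge0|]; apply: mulr_ge0.
have L0 : 0 <= A + B + C by rewrite !addr_ge0 ?elen_ge0.
have -> : 108 * cross u v ^+ 2 = 27 * (4 * cross u v ^+ 2) by ring.
rewrite E [27 * _]mulrCA [(A + B + C) ^+ 4]exprS ler_wpM2l //.
have -> : A + B + C = (A + B - C) + (C + A - B) + (C + B - A) by ring.
exact: amgm.
Qed.

Lemma orient_sqr_le x y z :
  108 * orient x y z ^+ 2 <= (dist x y + dist y z + dist z x) ^+ 4.
Proof.
have := cross_sqr_le (y - x) (z - y).
rewrite -orient_edges; have -> : y - x + (z - y) = z - x by rewrite addrC subrKA.
by rewrite -[elen (z - x)]/(dist x z) [dist x z]distC.
Qed.

(** Since 64 is at most 108, the bound for triangles is weakened to that of the square, and a single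
    bound serves for triangles and quadrilaterals. *)
Lemma cross_le (k L : R) : 0 <= L -> 108 * k ^+ 2 <= L ^+ 4 -> 8 * `|k| <= L ^+ 2.
Proof.
move=> L0 h; rewrite -(@ler_pXn2r _ 2) ?nnegrE ?mulr_ge0 ?sqr_ge0 //.
rewrite exprMn real_normK ?num_real // -exprM; apply: le_trans h.
by have := sqr_ge0 k; lra.
Qed.

(** [P] and [Q] are the difference and the sum of the diagonals, so their cross product is twice
    that of the diagonals, while each is also a difference of opposite sides. The
    arithmetic-geometric mean inequality finishes. *)
Lemma cross_diagonals_le a b c d :
  8 * `|cross (c - a) (d - b)| <= (dist a b + dist b c + dist c d + dist d a) ^+ 2.
Proof.
pose P := (b - a) - (d - c); pose Q := (c - b) - (a - d).
have hP : elen P <= dist a b + dist c d by rewrite /P -[dist c d]elenN; exact: elenD.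
have hQ : elen Q <= dist b c + dist d a by rewrite /Q -[dist d a]elenN; exact: elenD.
have -> : cross (c - a) (d - b) = cross P Q / 2.
  by rewrite /P /Q /cross !coordE; field.
have PQ : `|cross P Q| <= elen P * elen Q.
  rewrite -(@ler_pXn2r _ 2) ?nnegrE ?mulr_ge0 ?elen_ge0 // exprMn !sqr_elen.
  by rewrite -lagrange_identity real_normK ?num_real // lerDr sqr_ge0.
have P0 := elen_ge0 P; have Q0 := elen_ge0 Q.
rewrite normrM [`|2^-1|]ger0_norm ?invr_ge0 //.
have h : 4 * (elen P * elen Q) <= (elen P + elen Q) ^+ 2.
  rewrite -subr_ge0; have -> : (elen P + elen Q) ^+ 2 - 4 * (elen P * elen Q) =
    (elen P - elen Q) ^+ 2 by ring.
  exact: sqr_ge0.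
have h' : (elen P + elen Q) ^+ 2 <= (dist a b + dist b c + dist c d + dist d a) ^+ 2.
  by rewrite ler_pXn2r ?nnegrE ?addr_ge0 ?elen_ge0 //; lra.
by lra.
Qed.

(** For a hull whose diagonals are two opposite sides of the closed line: [b - a], [d - c] and their
    sum form a triangle whose third side is at most the sum of the other two sides of the line. *)
Lemma cross_opposite_le a b c d :
  8 * `|cross (b - a) (d - c)| <= (dist a b + dist b c + dist c d + dist d a) ^+ 2.
Proof.
have L0 : 0 <= dist a b + dist b c + dist c d + dist d a by rewrite !addr_ge0 ?elen_ge0.
apply: cross_le => //; apply: le_trans (cross_sqr_le _ _) _.
rewrite ler_pXn2r ?nnegrE ?addr_ge0 ?elen_ge0 //.
have : elen (b - a + (d - c)) <= dist b c + dist d a.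
  rewrite [dist b c]distC; have -> : b - a + (d - c) = (b - c) - (a - d).
    by apply: vec_eq; rewrite !coordE; ring.
  by rewrite -[dist d a]elenN; exact: elenD.
by rewrite -/(dist a b) -/(dist c d); lra.
Qed.

Lemma orient_le (x y z : R * R) (L : R) : dist x y + dist y z + dist z x <= L ->
  8 * `|orient x y z| <= L ^+ 2.
Proof.
move=> h; have L0 : 0 <= dist x y + dist y z + dist z x by rewrite !addr_ge0 ?elen_ge0.
apply: le_trans (cross_le L0 (orient_sqr_le x y z)) _.
by rewrite ler_pXn2r ?nnegrE // (le_trans L0).
Qed.

Lemma orient_perm x y z :
  (orient y z x = orient x y z) * (orient z x y = orient x y z) *
  (orient y x z = - orient x y z) * (orient x z y = - orient x y z) *
  (orient z y x = - orient x y z).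
Proof. by do !split; rewrite /orient /cross !coordE; ring. Qed.

Lemma orient_id x y : (orient x x y = 0) * (orient x y x = 0) * (orient x y y = 0).
Proof. by do !split; rewrite /orient /cross !coordE; ring. Qed.

(** Membership in the convex hull of a finite list, expressed by support functionals. *)
Definition supported (ps : seq (R * R)) x : Prop :=
  forall d, exists2 q, q \in ps & dot d x <= dot d q.

Lemma supported_left ps s a b x : supported ps x ->
  (forall q, q \in ps -> 0 <= s * orient a b q) -> 0 <= s * orient a b x.
Proof.
move=> sx left; have [q /left lq] := sx (- s *: perp (b - a)).
move: lq; rewrite !dotZl !dot_perp /orient /cross !coordE; lra.
Qed.

Lemma sub_supported ps qs x : {subset ps <= qs} -> supported ps x -> supported qs x.
Proof. by move=> sub sx d; have [q /sub qq h] := sx d; exists q. Qed.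

Lemma triangle_hull_area s a b c ps X : s = 1 \/ s = - 1 ->
    0 < s * orient a b c ->
    (forall q, q \in ps -> in_triangle s a b c q) ->
    (forall x, X x -> supported ps x) ->
  ((lebesgue_measure \x lebesgue_measure) X <= (s * orient a b c / 2)%:E)%E.
Proof.
move=> s1 D0 T sX; apply: triangle_area => // q /sX sq.
by split; apply: supported_left sq _ => r /T [].
Qed.

Lemma in_triangle1 s a b c : 0 <= s * orient a b c ->
  [/\ in_triangle s a b c a, in_triangle s a b c b & in_triangle s a b c c].
Proof.
have o1 x y : orient x y x = 0 by rewrite /orient /cross !coordE; ring.
have o2 x y : orient x y y = 0 by rewrite /orient /cross !coordE; ring.
have o3 : orient b c a = orient a b c by rewrite -orient_rot.
have o4 : orient c a b = orient a b c by rewrite orient_rot.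
by move=> h; split; split; rewrite ?o1 ?o2 ?o3 ?o4 ?mulr0.
Qed.

Lemma measurable_in_triangle s a b c : measurable [set q | in_triangle s a b c q].
Proof.
have m x y : measurable [set q : R * R | 0 <= s * orient x y q].
  have mf : measurable_fun setT (fun q : R * R => s * orient x y q).
    apply: measurable_funM; first exact: measurable_cst.
    apply: measurable_funB; (apply: measurable_funM; first exact: measurable_cst).
      by apply: (measurable_funB (f := snd) (g := cst x.2)); [exact: measurable_snd | exact: measurable_cst].
    by apply: (measurable_funB (f := fst) (g := cst x.1)); [exact: measurable_fst | exact: measurable_cst].
  have := mf measurableT _ (measurable_itv `[(0 : R), +oo[); rewrite setTI.
  by congr measurable; apply/seteqP; split=> q; rewrite /= in_itv /= andbT.
have -> : [set q | in_triangle s a b c q] =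
    [set q | 0 <= s * orient a b q] `&` [set q | 0 <= s * orient b c q] `&`
    [set q | 0 <= s * orient c a q].
  by apply/seteqP; split=> [q [? ? ?]|q [[? ?] ?]].
by apply: measurableI => //; apply: measurableI.
Qed.

(** The diagonal [ac] cuts the hull into two triangles, whose signed areas add up to half the cross
    product of the diagonals. *)
Lemma quadrilateral_hull_area s a b c d X : s = 1 \/ s = - 1 ->
    0 < s * orient a b c -> 0 < s * orient a c d ->
    0 <= s * orient b c d -> 0 <= s * orient a b d ->
    (forall x, X x -> supported [:: a; b; c; d] x) ->
  ((lebesgue_measure \x lebesgue_measure) X <= (`|cross (c - a) (d - b)| / 2)%:E)%E.
Proof.
move=> s1 abc acd bcd abd sX.
pose N := (orient_perm a b c, orient_perm a b d, orient_perm a c d, orient_perm b c d, orient_id).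
have n1 := ltW abc; have n2 := ltW acd.
have T1 x : X x -> 0 <= s * orient c a x -> in_triangle s a b c x.
  move=> /sX sx h; split=> //; apply: supported_left sx _ => q; rewrite !inE.
    by move=> /or4P[] /eqP ->; rewrite ?N ?mulr0.
  by move=> /or4P[] /eqP ->; rewrite ?N ?mulr0.
have T2 x : X x -> 0 <= s * orient a c x -> in_triangle s a c d x.
  move=> /sX sx h; split=> //; apply: supported_left sx _ => q; rewrite !inE.
    by move=> /or4P[] /eqP ->; rewrite ?N ?mulr0.
  by move=> /or4P[] /eqP ->; rewrite ?N ?mulr0.
pose A := [set q | in_triangle s a b c q]; pose B := [set q | in_triangle s a c d q].
have XAB : X `<=` A `|` B.
  move=> x Xx; case: (leP 0 (s * orient c a x)) => [h|h]; first by left; exact: T1.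
  by right; apply: T2 => //; move: h; rewrite orient_swap mulrN oppr_lt0 => /ltW.
have -> : `|cross (c - a) (d - b)| / 2 = s * orient a b c / 2 + s * orient a c d / 2.
  have E : s * cross (c - a) (d - b) = s * orient a b c + s * orient a c d.
    by rewrite /orient /cross !coordE; ring.
  have pos : 0 < s * cross (c - a) (d - b) by rewrite E addr_gt0.
  have -> : `|cross (c - a) (d - b)| = s * cross (c - a) (d - b).
    by rewrite -(gtr0_norm pos) normrM; case: s1 => ->; rewrite ?normrN normr1 mul1r.
  by rewrite E mulrDl.
apply: (@le_trans _ _ ((lebesgue_measure \x lebesgue_measure) (A `|` B))%E).
  apply: product_measure_le => x; apply: le_lebesgue_measure => y.
  by move=> /xsectionP /XAB h; apply/xsectionP.
apply: (@le_trans _ _ ((lebesgue_measure \x lebesgue_measure) A +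
    (lebesgue_measure \x lebesgue_measure) B)%E).
  by apply: measureU2; exact: measurable_in_triangle.
by rewrite EFinD leeD //; apply: triangle_area.
Qed.

(* The affine dependency between the four points has the signed areas as its
   coefficients: their signs tell a triangle containing the fourth point from a
   convex quadrilateral, whose diagonals join the points of equal sign. *)
Lemma four_points_hull_area a b c d X (B : R) :
    [|| orient a b c != 0, orient a b d != 0, orient a c d != 0 | orient b c d != 0] ->
    `|orient a b c| / 2 <= B -> `|orient a b d| / 2 <= B ->
    `|orient a c d| / 2 <= B -> `|orient b c d| / 2 <= B ->
    `|cross (c - a) (d - b)| / 2 <= B -> `|cross (b - a) (d - c)| / 2 <= B ->
    `|cross (d - a) (c - b)| / 2 <= B ->
    (forall x, X x -> supported [:: a; b; c; d] x) ->
  ((lebesgue_measure \x lebesgue_measure) X <= B%:E)%E.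
Proof.
move=> ne Babc Babd Bacd Bbcd Bac Bab Bad sX.
pose N := (orient_perm a b c, orient_perm a b d, orient_perm a c d, orient_perm b c d).
have tri s x y z w : s = 1 \/ s = - 1 -> {subset [:: a; b; c; d] <= [:: x; y; z; w]} ->
    `|orient x y z| / 2 <= B -> 0 < s * orient x y z ->
    0 <= s * orient x y w -> 0 <= s * orient y z w -> 0 <= s * orient z x w ->
    ((lebesgue_measure \x lebesgue_measure) X <= B%:E)%E.
  move=> s1 sub Bxyz D0 h1 h2 h3.
  have [t1 t2 t3] := in_triangle1 (ltW D0).
  apply: (@le_trans _ _ (s * orient x y z / 2)%:E).
    apply: (triangle_hull_area (ps := [:: x; y; z; w])) => // [q|q /sX]; last exact: sub_supported.
    by rewrite !inE => /or4P[] /eqP ->.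
  rewrite lee_fin (le_trans _ Bxyz) // ler_pM2r ?invr_gt0 //.
  rewrite -(gtr0_norm D0) normrM; case: s1 => ->; rewrite ?normrN normr1 mul1r //.
have quad s x y z w : s = 1 \/ s = - 1 -> {subset [:: a; b; c; d] <= [:: x; y; z; w]} ->
    `|cross (z - x) (w - y)| / 2 <= B ->
    0 < s * orient x y z -> 0 < s * orient x z w ->
    0 <= s * orient y z w -> 0 <= s * orient x y w ->
    ((lebesgue_measure \x lebesgue_measure) X <= B%:E)%E.
  move=> s1 sub Bxy D1 D2 h1 h2; apply: (@le_trans _ _ (`|cross (z - x) (w - y)| / 2)%:E).
    by apply: (quadrilateral_hull_area s1) => // q /sX; exact: sub_supported.
  by rewrite lee_fin.
pose e1 : (1 : R) = 1 \/ (1 : R) = - 1 := or_introl erefl.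
pose e2 : (-1 : R) = 1 \/ (-1 : R) = - 1 := or_intror erefl.
have flip x y z w : cross (z - x) (w - y) = cross (w - y) (x - z).
  by rewrite /cross !coordE; ring.
have sum0 : orient b c d - orient a c d + orient a b d - orient a b c = 0.
  by rewrite /orient /cross !coordE; ring.
(* Of the sixteen sign patterns, the two in which all terms of [sum0] have the same sign are
   impossible; one term against three gives a triangle, two against two a convex quadrilateral. *)
case: (leP 0 (orient b c d)) => ha; case: (leP (orient a c d) 0) => hb;
  case: (leP 0 (orient a b d)) => hc; case: (leP (orient a b c) 0) => hd.
- by exfalso; move: ne; rewrite !neq_lt => /or4P[] /orP[] ne; clear -ne sum0 ha hb hc hd; lra.
- apply: (tri 1 a b c d) => //; rewrite ?N; perm_signs sum0 ha hb hc hd.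
- apply: (tri (-1) a b d c) => //; rewrite ?N; perm_signs sum0 ha hb hc hd.
- apply: (quad (-1) a c b d) => //; rewrite ?N; perm_signs sum0 ha hb hc hd.
- apply: (tri 1 a c d b) => //; rewrite ?N; perm_signs sum0 ha hb hc hd.
- apply: (quad 1 a b c d) => //; rewrite ?N; perm_signs sum0 ha hb hc hd.
- apply: (quad (-1) a b d c) => //; rewrite ?N; perm_signs sum0 ha hb hc hd.
- apply: (tri 1 b c d a) => //; rewrite ?N; perm_signs sum0 ha hb hc hd.
- apply: (tri (-1) b c d a) => //; rewrite ?N; perm_signs sum0 ha hb hc hd.
- apply: (quad 1 b d c a) => //; [perm_signs sum0 ha hb hc hd | by rewrite -flip | ..]; rewrite ?N; perm_signs sum0 ha hb hc hd.
- apply: (quad (-1) b c d a) => //; [perm_signs sum0 ha hb hc hd | by rewrite -flip | ..]; rewrite ?N; perm_signs sum0 ha hb hc hd.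
- apply: (tri (-1) a c d b) => //; rewrite ?N; perm_signs sum0 ha hb hc hd.
- apply: (quad 1 c b d a) => //; [perm_signs sum0 ha hb hc hd | by rewrite -flip | ..]; rewrite ?N; perm_signs sum0 ha hb hc hd.
- apply: (tri 1 a b d c) => //; rewrite ?N; perm_signs sum0 ha hb hc hd.
- apply: (tri (-1) a b c d) => //; rewrite ?N; perm_signs sum0 ha hb hc hd.
- by exfalso; clear -sum0 ha hb hc hd; lra.
Qed.

End Isoperimetric.

(** * Cyclic indices modulo five *)

Lemma ordS5 (i : 'I_5) : ordS (ordS (ordS (ordS (ordS i)))) = i.
Proof. by apply: val_inj; case: i => [[|[|[|[|[|?]]]]] hi]. Qed.

Lemma ord5_cases (i j : 'I_5) :
  [\/ j = i, j = ordS i, j = ordS (ordS i) | j = ordS (ordS (ordS i)) \/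
      j = ordS (ordS (ordS (ordS i)))].
Proof.
have [|] := boolP [|| j == i, j == ordS i, j == ordS (ordS i),
    j == ordS (ordS (ordS i)) | j == ordS (ordS (ordS (ordS i)))].
  by move=> /or4P[/eqP|/eqP|/eqP|/orP[] /eqP]; [constructor 1 | constructor 2 |
    constructor 3 | constructor 4; left | constructor 4; right].
by case: i => [[|[|[|[|[|?]]]]] hi] //; case: j => [[|[|[|[|[|?]]]]] hj].
Qed.

Lemma ord5_uniq (i : 'I_5) :
  uniq [:: i; ordS i; ordS (ordS i); ordS (ordS (ordS i)); ordS (ordS (ordS (ordS i)))].
Proof. by case: i => [[|[|[|[|[|?]]]]] hi]. Qed.

Lemma sum_ord5 (V : zmodType) (F : 'I_5 -> V) (i : 'I_5) :
  \sum_j F j = F i + F (ordS i) + F (ordS (ordS i)) + F (ordS (ordS (ordS i))) +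
    F (ordS (ordS (ordS (ordS i)))).
Proof.
rewrite -(big_map id xpredT F) /=.
rewrite (perm_big [:: i; ordS i; ordS (ordS i); ordS (ordS (ordS i));
                      ordS (ordS (ordS (ordS i)))]).
  by rewrite !big_cons big_nil /= addr0 !addrA.
rewrite map_id; apply: uniq_perm; rewrite ?index_enum_uniq ?ord5_uniq // => j.
rewrite mem_index_enum !inE; apply/esym.
by case: (ord5_cases i j) => [->|->|->|[->|->]]; rewrite eqxx ?orbT.
Qed.

(** * Counting the reflex vertices of a pentagon *)

Section Pentagon.
Variables (R : realType) (p : 'I_5 -> R * R).
Hypothesis hp : simple_polygon p.
Implicit Types (i j k : 'I_5) (x y : R * R).

Let i0 : 'I_5 := ord0.

Lemma turnE i : cross (edge p i) (edge p (ordS i)) =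
  orient (p i) (p (ordS i)) (p (ordS (ordS i))).
Proof. by rewrite orient_edges. Qed.

Lemma apart_sides i j t t' : 0 <= t <= 1 -> 0 <= t' <= 1 ->
  [&& i != j, j != ordS i & i != ordS j] -> side_pt p i t <> side_pt p j t'.
Proof.
move=> t0 t1 /and3P[n1 n2 n3] e.
by case: (sides_meet hp t0 t1 e) => [[h _]|[h _ _]|[h _ _]];
  [move: n1 | move: n2 | move: n3]; rewrite h eqxx.
Qed.

(** Relative to side [i], the two vertices next to it are placed by the turns at its ends; only the
    opposite vertex needs [five_points_convex]. *)
Lemma no_reflex_convex s : oriented p s ->
  (forall i, 0 <= s * cross (edge p i) (edge p (ordS i))) -> convex_polygon p.
Proof.
move=> os pos; apply: (convex_position hp os) => // i j.
have := pos i; have := pos (ordS i); have := pos (ordS (ordS i)).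
have := pos (ordS (ordS (ordS i))); have := pos (ordS (ordS (ordS (ordS i)))).
rewrite !turnE ordS5 => h4 h3 h2 h1 h0.
case: (ord5_cases i j) => [->|->|->|[->|->]].
- by rewrite subrr /cross /= !mulr0 subrr mulr0.
- by rewrite /edge /cross [X in X - _]mulrC subrr mulr0.
- exact: h0.
- have u := ord5_uniq i.
  apply: (five_points_convex h0 h1 h2 h3 h4).
  + by rewrite -turnE => /(aligned_edges hp).
  + move=> t t' t0 t1; apply: (@apart_sides i (ordS (ordS i))) => //.
    by clear -i; case: i => [[|[|[|[|[|?]]]]] hi].
  + move=> t t' t0 t1.
    have -> : p (ordS (ordS (ordS (ordS i)))) +
        t' *: (p (ordS (ordS (ordS i))) - p (ordS (ordS (ordS (ordS i))))) =
        side_pt p (ordS (ordS (ordS i))) (1 - t').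
      by rewrite side_ptE /edge; apply: vec_eq; rewrite !coordE; ring.
    apply: apart_sides => //; first by clear -t1; lra.
    by clear -i; case: i => [[|[|[|[|[|?]]]]] hi].
  + move=> t t' t0 t1.
    have -> : p i + t' *: (p (ordS (ordS (ordS (ordS i)))) - p i) =
        side_pt p (ordS (ordS (ordS (ordS i)))) (1 - t').
      by rewrite side_ptE /edge ordS5; apply: vec_eq; rewrite !coordE; ring.
    apply: apart_sides => //; first by clear -t1; lra.
    by clear -i; case: i => [[|[|[|[|[|?]]]]] hi].
- by move: h4; rewrite orient_rot.
Qed.

(** Three noncollinear vertices are nonreflex. *)
Lemma reflex_card_le2 : (#|reflex p| <= 2)%N.
Proof.
have [k1 r1 _] := nonreflex_max hp (1, 0) i0.
(* The auxiliary point only serves to span a line through [p k1]; a vertex off this line is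
   different from [k1]. *)
have ne : p k1 != p k1 + (1, 0).
  rewrite -subr_eq0 opprD addNKr oppr_eq0 -dot_gt0 /dot /= mulr1 mulr0 addr0.
  exact: ltr01.
have [k2 r2 o2] := nonreflex_noncollinear hp i0 ne.
have n12 : k1 != k2.
  by apply: contraNneq o2 => <-; rewrite /orient subrr /cross /= !mulr0 subrr.
have np : p k1 != p k2 by rewrite (inj_eq (vertex_inj hp)).
have [k3 r3 o3] := nonreflex_noncollinear hp i0 np.
have n13 : k1 != k3.
  by apply: contraNneq o3 => <-; rewrite orient_id.
have n23 : k2 != k3.
  by apply: contraNneq o3 => <-; rewrite orient_id.
have sub : [set k1; k2; k3]%SET \subset (~: reflex p)%SET.
  by apply/fintype.subsetP => k; rewrite !inE => /orP[/orP[]|] /eqP ->; move: r1 r2 r3; rewrite !inE.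
have := subset_leq_card sub.
have -> : #|[set k1; k2; k3]%SET| = 3.
  by rewrite finset.setUC cardsU1 cards2 !inE n12 ![k3 == _]eq_sym (negbTE n13) (negbTE n23).
by have := cardsC (reflex p); rewrite card_ord; lia.
Qed.

End Pentagon.

(** * Angle and perimeter bounds for the two types *)

Section Pentagon.
Variables (R : realType) (p : 'I_5 -> R * R).
Hypothesis hp : simple_polygon p.
Implicit Types (i j k : 'I_5) (x y : R * R).

Let i0 : 'I_5 := ord0.

Lemma reflex_orient s i : oriented p s -> (ordS i \in reflex p) =
  (s * orient (p i) (p (ordS i)) (p (ordS (ordS i))) < 0).
Proof. by move=> os; rewrite (reflexP hp i os) turnE. Qed.

(** A half-plane containing the nonreflex vertices contains their hull, hence every vertex. *)
Lemma left_of_nonreflex s x y :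
  (forall k, k \notin reflex p -> 0 <= s * orient x y (p k)) ->
  forall j, 0 <= s * orient x y (p j).
Proof.
move=> left j; have [k /left lk kmax] := nonreflex_max hp (- s *: perp (y - x)) i0.
move: (kmax j) lk; rewrite !dotZl !dot_perp /orient /cross !coordE; lra.
Qed.

Lemma reflex2_cases : #|reflex p| = 2%N -> exists i,
  reflex p = [set ordS (ordS i); ordS (ordS (ordS i))]%SET \/
  reflex p = [set ordS i; ordS (ordS (ordS i))]%SET.
Proof.
move/eqP/cards2P => [x [y [xy ->]]].
case: (ord5_cases x y) xy => [->|->|->|[->|->]] xy.
- by case/eqP: xy.
- by exists (ordS (ordS (ordS x))); left; rewrite ordS5.
- by exists (ordS (ordS (ordS (ordS x)))); right; rewrite ordS5.
- by exists (ordS (ordS x)); right; rewrite ordS5 finset.setUC.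
- by exists (ordS (ordS x)); left; rewrite ordS5 finset.setUC.
Qed.

Lemma oriented_pm s : oriented p s -> s = 1 \/ s = - 1.
Proof. by case. Qed.

Lemma reflex_angle_vertex s i : oriented p s -> ordS i \in reflex p ->
  interior_angle p (ordS i) =
  2 * pi - angle (p (ordS (ordS i)) - p (ordS i)) (p i - p (ordS i)).
Proof. by move=> os ri; rewrite (reflex_angle hp os ri) /edge opprB. Qed.

(** [adjacent_angles] applies to the complements of the two angles to [2 * pi], as both reflex
    vertices lie in the triangle of the nonreflex ones. *)
Lemma adjacent_reflex_angles s i : oriented p s ->
    reflex p = [set ordS (ordS i); ordS (ordS (ordS i))]%SET ->
  interior_angle p (ordS (ordS i)) + interior_angle p (ordS (ordS (ordS i))) < 3 * pi.
Proof.
move=> os rE.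
have r2 : ordS (ordS i) \in reflex p by rewrite rE !inE eqxx.
have r3 : ordS (ordS (ordS i)) \in reflex p by rewrite rE !inE eqxx orbT.
have nr k : k \notin reflex p ->
    [\/ k = i, k = ordS i | k = ordS (ordS (ordS (ordS i)))].
  rewrite rE !inE; case: (ord5_cases i k) => [->|->|->|[->|->]];
    rewrite ?eqxx ?orbT // => _; [by constructor 1 | by constructor 2 | by constructor 3].
have ni : i \notin reflex p.
  by rewrite rE !inE; clear; case: i => [[|[|[|[|[|?]]]]] hi].
rewrite (reflex_angle_vertex os r2) (reflex_angle_vertex os r3).
have ni' : ordS (ordS (ordS (ordS (ordS i)))) \notin reflex p by rewrite ordS5.
move: (r2) (r3) ni'; rewrite !(reflex_orient _ os) !ordS5 -leNgt => o2 o3 o0.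
set m := p i in o0 *; set k := p (ordS i) in o0 o2 *.
set a := p (ordS (ordS i)) in o2 o3 *; set b := p (ordS (ordS (ordS i))) in o2 o3 *.
set l := p (ordS (ordS (ordS (ordS i)))) in o0 o3 *.
have mka : 0 <= s * orient m k a.
  apply: left_of_nonreflex => j /nr [] ->; rewrite -/m -/k -/l ?orient_id ?mulr0 //.
  by rewrite -orient_rot.
have lmb : 0 <= s * orient l m b.
  by apply: left_of_nonreflex => j /nr [] ->; rewrite -/m -/k -/l ?orient_id ?mulr0.
(* Some nonreflex vertex is weakly left of the line [ab]; [k] and [l] are strictly right of it,
   because [a] and [b] are reflex, so it is [m]. *)
have abm : 0 <= s * orient a b m.
  have [j /nr jr jmax] := nonreflex_max hp (s *: perp (b - a)) i0.
  have : s * orient a b a <= s * orient a b (p j).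
    have := jmax (ordS (ordS i)); rewrite -/a !dotZl !dot_perp /orient /cross !coordE; lra.
  rewrite orient_id mulr0; case: jr => -> //; rewrite -/k -/l => h.
    by move: o2; rewrite orient_rot ltNge h.
  by move: o3; rewrite ltNge h.
have := adjacent_angles (oriented_pm os) o2 o3 mka lmb abm.
lra.
Qed.

Lemma nonadjacent_reflex_angles s i : oriented p s ->
    reflex p = [set ordS i; ordS (ordS (ordS i))]%SET ->
  interior_angle p (ordS i) + interior_angle p (ordS (ordS (ordS i))) < 3 * pi.
Proof.
move=> os rE.
have r1 : ordS i \in reflex p by rewrite rE !inE eqxx.
have r3 : ordS (ordS (ordS i)) \in reflex p by rewrite rE !inE eqxx orbT.
have nr k : k \notin reflex p ->
    [\/ k = i, k = ordS (ordS i) | k = ordS (ordS (ordS (ordS i)))].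
  rewrite rE !inE; case: (ord5_cases i k) => [->|->|->|[->|->]];
    rewrite ?eqxx ?orbT // => _; [by constructor 1 | by constructor 2 | by constructor 3].
have ni : i \notin reflex p.
  by rewrite rE !inE; clear; case: i => [[|[|[|[|[|?]]]]] hi].
have n2 : ordS (ordS i) \notin reflex p.
  by rewrite rE !inE; clear; case: i => [[|[|[|[|[|?]]]]] hi].
rewrite (reflex_angle_vertex os r1) (reflex_angle_vertex os r3).
have ni' : ordS (ordS (ordS (ordS (ordS i)))) \notin reflex p by rewrite ordS5.
move: (r1) (r3) (n2) ni'; rewrite !(reflex_orient _ os) !ordS5 -!leNgt => o1 o3 o2 o0.
have ab : p (ordS i) != p (ordS (ordS (ordS i))).
  rewrite (inj_eq (vertex_inj hp)).
  by clear; case: i => [[|[|[|[|[|?]]]]] hi].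
have kl : p i != p (ordS (ordS i)).
  rewrite (inj_eq (vertex_inj hp)).
  by clear; case: i => [[|[|[|[|[|?]]]]] hi].
have [j /nr jr jo] := nonreflex_noncollinear hp i0 kl.
have al := @aligned_edges _ _ _ hp (ordS (ordS (ordS (ordS i)))).
rewrite turnE !ordS5 /edge !ordS5 in al.
set k := p i in o0 o1 kl jo al *; set a := p (ordS i) in o0 o1 o2 ab al *.
set l := p (ordS (ordS i)) in o1 o2 o3 kl jo *.
set b := p (ordS (ordS (ordS i))) in o2 o3 ab *.
set m := p (ordS (ordS (ordS (ordS i)))) in o0 o3 jo al *.
have klm0 : orient k l m != 0.
  by case: jr jo => ->; rewrite -/k -/l -/m ?orient_id ?eqxx.
(* With the opposite orientation, the hull and the turn at [k] would make [m], [k], [a] collinear,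
   with [a] beyond [k] as sides do not fold back; then [a] would leave the hull across the line
   [kl]. *)
have klm : 0 < s * orient k l m.
  rewrite ltNge le_eqVlt mulf_eq0 (negbTE klm0) (negbTE (oriented_neq0 os)) /=.
  apply/negP => neg.
  have mka : 0 <= - s * orient m k a.
    apply: left_of_nonreflex => z /nr [] ->; rewrite -/m -/k -/l ?orient_id ?mulr0 //.
    by rewrite (orient_rot m k l) mulNr oppr_ge0 ltW.
  have : orient m k a = 0.
    have : s * orient m k a = 0 by apply/eqP; rewrite eq_le o0 andbT -oppr_ge0 -mulNr.
    by move/eqP; rewrite mulf_eq0 (negbTE (oriented_neq0 os)) => /eqP.
  move=> /al [t t0 ae].
  have kla : 0 <= - s * orient k l a.
    apply: left_of_nonreflex => z /nr [] ->; rewrite -/m -/k -/l ?orient_id ?mulr0 //.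
    by rewrite mulNr oppr_ge0 ltW.
  have E : - s * orient k l a = t * (s * orient k l m).
    have -> : a = k + t *: (k - m) by rewrite -ae subrKC.
    by rewrite /orient /cross !coordE; ring.
  by move: kla; rewrite E leNgt pmulr_rlt0 ?neg.
have mkb : 0 <= s * orient m k b.
  apply: left_of_nonreflex => z /nr [] ->; rewrite -/m -/k -/l ?orient_id ?mulr0 //.
  by rewrite orient_rot ltW.
have lma : 0 <= s * orient l m a.
  apply: left_of_nonreflex => z /nr [] ->; rewrite -/m -/k -/l ?orient_id ?mulr0 //.
  by rewrite -orient_rot ltW.
have := nonadjacent_angles (oriented_pm os) klm o1 o3 lma o0 mkb o2 ab.
lra.
Qed.

Lemma nonconvex_types : ~ convex_polygon p -> type1 p \/ type2 p.
Proof.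
move=> ncv; have [s os] := oriented_exists hp i0.
have c0 : #|reflex p| != 0%N.
  apply/negP => /eqP /cards0_eq r0; apply: ncv; apply: (no_reflex_convex hp os) => i.
  by rewrite leNgt -(reflexP hp i os) r0 inE.
have := reflex_card_le2 hp; case c : #|reflex p| c0 => [|[|[|?]]] // _ _.
  by left.
right; split=> //; have [i [rE|rE]] := reflex2_cases c.
  have := adjacent_reflex_angles os rE.
  rewrite rE big_setU1 ?big_set1 /=; last first.
    by rewrite inE; clear; case: i => [[|[|[|[|[|?]]]]] hi].
  lra.
have := nonadjacent_reflex_angles os rE.
rewrite rE big_setU1 ?big_set1 /=; last first.
  by rewrite inE; clear; case: i => [[|[|[|[|[|?]]]]] hi].
lra.
Qed.

Lemma perimeterE i : perimeter p =
  dist (p i) (p (ordS i)) + dist (p (ordS i)) (p (ordS (ordS i))) +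
  dist (p (ordS (ordS i))) (p (ordS (ordS (ordS i)))) +
  dist (p (ordS (ordS (ordS i)))) (p (ordS (ordS (ordS (ordS i))))) +
  dist (p (ordS (ordS (ordS (ordS i))))) (p i).
Proof. by rewrite /perimeter (sum_ord5 _ i) ordS5. Qed.

Lemma region_supported (ps : seq (R * R)) x :
  (forall k, k \notin reflex p -> p k \in ps) -> region p x -> supported ps x.
Proof.
move=> sub rx d; have [j rj xj] := region_support_nonreflex hp d i0 rx.
by exists (p j) => //; exact: sub.
Qed.

Lemma reflex_orient_neq0 i : ordS i \in reflex p ->
  orient (p i) (p (ordS i)) (p (ordS (ordS i))) != 0.
Proof.
have [s os] := oriented_exists hp i0; rewrite (reflex_orient i os) => neg.
by apply/eqP => z; move: neg; rewrite z mulr0 ltxx.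
Qed.

(** Skipping the reflex vertex [q] strictly shortens the perimeter to [L]. Every triangle and every
    pair of diagonals that the hull of the other four vertices may have obeys the bound
    [L ^+ 2 / 16], and this hull contains the region of area 1. *)
Lemma type1_perimeter : type1 p -> area p = 1%E -> 4 < perimeter p.
Proof.
move/eqP/cards1P => [x]; elim/ord_predP: x => i rE ar.
have ri : ordS i \in reflex p by rewrite rE inE.
have := reflex_orient_neq0 ri => /dist_triangle_lt lt.
have nr k : k \notin reflex p -> [\/ k = i, k = ordS (ordS i) |
   k = ordS (ordS (ordS i)) \/ k = ordS (ordS (ordS (ordS i)))].
  rewrite rE !inE; case: (ord5_cases i k) => [->|->|->|[->|->]];
    rewrite ?eqxx ?orbT // => _; [by constructor 1 | by constructor 2 |
      by constructor 3; left | by constructor 3; right].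
have ne : p i != p (ordS (ordS i)).
  rewrite (inj_eq (vertex_inj hp)); clear; by case: i => [[|[|[|[|[|?]]]]] hi].
have [k rk ok] := nonreflex_noncollinear hp i0 ne.
rewrite (perimeterE i).
set q := p (ordS i) in lt *; set a := p i in lt ne ok *.
set b := p (ordS (ordS i)) in lt ne ok *; set c := p (ordS (ordS (ordS i))).
set d := p (ordS (ordS (ordS (ordS i)))).
set L := dist a b + dist b c + dist c d + dist d a.
have L0 : 0 <= L by rewrite !addr_ge0 ?elen_ge0.
suff L4 : 4 <= L by move: L4; rewrite /L; lra.
have bound r : 8 * `|r| <= L ^+ 2 -> `|r| / 2 <= L ^+ 2 / 16 by lra.
have tca := dist_triangle d c a; have tbd := dist_triangle c b d.
have tac := dist_triangle b a c; have tdb := dist_triangle a d b.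
have sX x : region p x -> supported [:: a; b; c; d] x.
  apply: region_supported => j /nr [->|->|[->|->]]; rewrite !inE eqxx ?orbT //.
have nz : [|| orient a b c != 0, orient a b d != 0, orient a c d != 0 | orient b c d != 0].
  by case: (nr _ rk) ok => [->|->|[->|->]]; rewrite -/a -/b -/c -/d ?orient_id ?eqxx // => ->;
    rewrite ?orbT.
have := @four_points_hull_area _ a b c d (region p) (L ^+ 2 / 16) nz.
rewrite -/(area p) ar lee_fin => /(_ _ _ _ _ _ _ _ sX) h.
have : 1 <= L ^+ 2 / 16.
  apply: h; apply: bound; rewrite ?cross_diagonals_le ?cross_opposite_le //.
  - by apply: orient_le; rewrite /L; lra.
  - by apply: orient_le; rewrite /L; lra.
  - by apply: orient_le; rewrite /L; lra.
  - by apply: orient_le; rewrite /L; lra.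
  - have -> : cross (d - a) (c - b) = cross (c - b) (a - d) by rewrite /cross !coordE; ring.
    have -> : L = dist b c + dist c d + dist d a + dist a b by rewrite /L; ring.
    exact: cross_opposite_le.
move=> h1; rewrite -(@ler_pXn2r _ 2) ?nnegrE //; lra.
Qed.

Lemma triangle_perimeter_ge i j k : orient (p i) (p j) (p k) != 0 ->
    (forall l, l \notin reflex p -> p l \in [:: p i; p j; p k]) -> area p = 1%E ->
  3 * Num.sqrt (4 / Num.sqrt 3) <= dist (p i) (p j) + dist (p j) (p k) + dist (p k) (p i).
Proof.
move=> o sub ar; set L := _ + _ + _.
have L0 : 0 <= L by rewrite !addr_ge0 ?elen_ge0.
have [s s1 so] : exists2 s : R, s = 1 \/ s = - 1 & 0 < s * orient (p i) (p j) (p k).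
  move: o; rewrite neq_lt => /orP[lt|gt].
    by exists (- 1); [right | rewrite mulN1r oppr_gt0].
  by exists 1; [left | rewrite mul1r].
have [t1 t2 t3] := in_triangle1 (ltW so).
have := @triangle_hull_area _ s _ _ _ [:: p i; p j; p k] (region p) s1 so.
rewrite -/(area p) ar lee_fin => h.
have D2 : 2 <= s * orient (p i) (p j) (p k).
  suff : 1 <= s * orient (p i) (p j) (p k) / 2 by lra.
  apply: h => [q|x rx]; last exact: region_supported rx.
  by rewrite !inE => /or3P[] /eqP ->.
(* 432 is [108 * 2 ^+ 2], and it is also the fourth power of [3 * Num.sqrt (4 / Num.sqrt 3)]. *)
have L4 : 432 <= L ^+ 4.
  apply: le_trans (orient_sqr_le _ _ _).
  have -> : orient (p i) (p j) (p k) ^+ 2 = (s * orient (p i) (p j) (p k)) ^+ 2.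
    by rewrite exprMn; case: s1 => ->; rewrite ?sqrrN expr1n mul1r.
  have : 2 ^+ 2 <= (s * orient (p i) (p j) (p k)) ^+ 2.
    by rewrite ler_pXn2r ?nnegrE // ltW.
  lra.
have s3 : 0 < Num.sqrt 3 :> R by rewrite sqrtr_gt0.
rewrite -(@ler_pXn2r _ 4) ?nnegrE ?mulr_ge0 ?sqrtr_ge0 //.
apply: le_trans L4; rewrite le_eqVlt; apply/orP; left; apply/eqP.
rewrite exprMn -[4%N]/(2 * 2)%N !exprM sqr_sqrtr ?divr_ge0 ?ltW //.
by rewrite expr_div_n sqr_sqrtr //; field.
Qed.

(** Skipping both reflex vertices leaves the triangle of nonreflex ones; strictness comes from one
    reflex vertex, which is never aligned with its neighbours. *)
Lemma type2_perimeter : type2 p -> area p = 1%E ->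
  3 * Num.sqrt (4 / Num.sqrt 3) < perimeter p.
Proof.
case=> /reflex2_cases [i [rE|rE]] _ ar.
  have r2 : ordS (ordS i) \in reflex p by rewrite rE !inE eqxx.
  have lt := dist_triangle_lt (reflex_orient_neq0 r2).
  have tr := dist_triangle (p (ordS (ordS (ordS i)))) (p (ordS i)) (p (ordS (ordS (ordS (ordS i))))).
  have nr l : l \notin reflex p ->
      p l \in [:: p i; p (ordS i); p (ordS (ordS (ordS (ordS i))))].
    by rewrite rE !inE; case: (ord5_cases i l) => [->|->|->|[->|->]]; rewrite ?eqxx ?orbT.
  have ne : p i != p (ordS i).
    by rewrite (inj_eq (vertex_inj hp)); clear; case: i => [[|[|[|[|[|?]]]]] hi].
  have [k /nr rk ok] := nonreflex_noncollinear hp i0 ne.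
  have o : orient (p i) (p (ordS i)) (p (ordS (ordS (ordS (ordS i))))) != 0.
    by move: rk ok; rewrite !inE => /or3P[] /eqP ->; rewrite ?orient_id ?eqxx.
  have := triangle_perimeter_ge o nr ar; rewrite (perimeterE i); lra.
have r1 : ordS i \in reflex p by rewrite rE !inE eqxx.
have lt := dist_triangle_lt (reflex_orient_neq0 r1).
have tr := dist_triangle (p (ordS (ordS (ordS i)))) (p (ordS (ordS i))) (p (ordS (ordS (ordS (ordS i))))).
have nr l : l \notin reflex p ->
    p l \in [:: p i; p (ordS (ordS i)); p (ordS (ordS (ordS (ordS i))))].
  by rewrite rE !inE; case: (ord5_cases i l) => [->|->|->|[->|->]]; rewrite ?eqxx ?orbT.
have ne : p i != p (ordS (ordS i)).
  by rewrite (inj_eq (vertex_inj hp)); clear; case: i => [[|[|[|[|[|?]]]]] hi].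
have [k /nr rk ok] := nonreflex_noncollinear hp i0 ne.
have o : orient (p i) (p (ordS (ordS i))) (p (ordS (ordS (ordS (ordS i))))) != 0.
  by move: rk ok; rewrite !inE => /or3P[] /eqP ->; rewrite ?orient_id ?eqxx.
have := triangle_perimeter_ge o nr ar; rewrite (perimeterE i); lra.
Qed.

End Pentagon.

(** * Pentagons with adjacent and with non-adjacent reflex vertices *)

Ltac by_coordinates E :=
  have := congr1 snd E; have := congr1 fst E; rewrite /= ?coordE /GRing.scale /=; clear E; lra.

Section Examples.
Variable R : realType.

Definition five_points (a b c d e : R * R) (i : 'I_5) : R * R :=
  nth a [:: a; b; c; d; e] i.

Definition o0 : 'I_5 := @Ordinal 5 0 isT.
Definition o1 : 'I_5 := @Ordinal 5 1 isT.
Definition o2 : 'I_5 := @Ordinal 5 2 isT.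
Definition o3 : 'I_5 := @Ordinal 5 3 isT.
Definition o4 : 'I_5 := @Ordinal 5 4 isT.

Lemma ord5_ind (P : 'I_5 -> Prop) : P o0 -> P o1 -> P o2 -> P o3 -> P o4 -> forall i, P i.
Proof.
move=> h0 h1 h2 h3 h4 [[|[|[|[|[|?]]]]] hi] //; rewrite (bool_irrelevance hi isT) //.
Qed.

Lemma ordS_o : [/\ ordS o0 = o1, ordS o1 = o2, ordS o2 = o3, ordS o3 = o4 & ordS o4 = o0].
Proof. by split; apply: val_inj. Qed.

Lemma five_points_simple a b c d e :
  let side (u v : R * R) (t : R) := u + t *: (v - u) in
  let apart u v x y := forall s t : R, 0 <= s < 1 -> 0 <= t < 1 -> side u v s <> side x y t in
  [/\ a != b, b != c, c != d, d != e & e != a] ->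
  [/\ apart a b b c, apart b c c d, apart c d d e, apart d e e a & apart e a a b] ->
  [/\ apart a b c d, apart b c d e, apart c d e a, apart d e a b & apart e a b c] ->
  simple_polygon (five_points a b c d e).
Proof.
move=> side apart [n0 n1 n2 n3 n4] [a0 a1 a2 a3 a4] [b0 b1 b2 b3 b4].
have [S0 S1 S2 S3 S4] := ordS_o.
have own (u v : R * R) (s t : R) : u != v -> side u v s = side u v t -> s = t.
  move=> uv /addrI /eqP; rewrite -subr_eq0 -scalerBl scaler_eq0 !subr_eq0.
  by rewrite [v == u]eq_sym (negbTE uv) orbF => /eqP.
elim/ord5_ind => j; elim/ord5_ind: j => s t hs ht; rewrite /side_pt ?S0 ?S1 ?S2 ?S3 ?S4 /= => E.
all: first
  [ by split=> //; apply: own E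
  | by case: (a0 _ _ hs ht E) | by case: (a1 _ _ hs ht E) | by case: (a2 _ _ hs ht E)
  | by case: (a3 _ _ hs ht E) | by case: (a4 _ _ hs ht E) | by case: (b0 _ _ hs ht E)
  | by case: (b1 _ _ hs ht E) | by case: (b2 _ _ hs ht E) | by case: (b3 _ _ hs ht E)
  | by case: (b4 _ _ hs ht E)
  | by case: (a0 _ _ ht hs (esym E)) | by case: (a1 _ _ ht hs (esym E))
  | by case: (a2 _ _ ht hs (esym E)) | by case: (a3 _ _ ht hs (esym E))
  | by case: (a4 _ _ ht hs (esym E)) | by case: (b0 _ _ ht hs (esym E))
  | by case: (b1 _ _ ht hs (esym E)) | by case: (b2 _ _ ht hs (esym E))
  | by case: (b3 _ _ ht hs (esym E)) | by case: (b4 _ _ ht hs (esym E)) ].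
Qed.

Lemma reflex_five_points s a b c d e : let p := five_points a b c d e in
  simple_polygon p -> oriented p s ->
  [/\ (o0 \in reflex p) = (s * orient e a b < 0), (o1 \in reflex p) = (s * orient a b c < 0),
      (o2 \in reflex p) = (s * orient b c d < 0), (o3 \in reflex p) = (s * orient c d e < 0) &
      (o4 \in reflex p) = (s * orient d e a < 0)].
Proof.
move=> p hp os; have [S0 S1 S2 S3 S4] := ordS_o.
split.
- by rewrite -{1}S4 (reflex_orient hp _ os) S4 S0.
- by rewrite -{1}S0 (reflex_orient hp _ os) S0 S1.
- by rewrite -{1}S1 (reflex_orient hp _ os) S1 S2.
- by rewrite -{1}S2 (reflex_orient hp _ os) S2 S3.
- by rewrite -{1}S3 (reflex_orient hp _ os) S3 S4.
Qed.

(** The bound on the average comes from the general classification, so no angle of the examples has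
    to be computed. *)
Lemma two_reflex_type2 (p : 'I_5 -> R * R) i j : pentagon p -> i != j ->
  reflex p = [set i; j]%SET -> ~ convex_polygon p /\ type2 p.
Proof.
move=> hp ij rE; have nc : ~ convex_polygon p.
  by apply: reflex_not_convex => //; exists i; rewrite rE !inE eqxx.
split=> //; have [] := nonconvex_types hp nc => //.
by rewrite /type1 rE cards2 ij.
Qed.

(** An isosceles triangle whose base is pushed inwards along a segment. *)
Definition adjacent_example : 'I_5 -> R * R :=
  five_points (0, 4) (- 4, - 4) (- 1, - 1) (1, - 1) (4, - 4).

Lemma adjacent_example_simple : simple_polygon adjacent_example.
Proof.
by apply: five_points_simple; split;
  first [apply/eqP => E | move=> s t hs ht E]; by_coordinates E.
Qed.

Lemma adjacent_example_reflex : reflex adjacent_example = [set o2; o3]%SET.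
Proof.
have hp := adjacent_example_simple; have [S0 S1 S2 S3 S4] := ordS_o.
have [s os] := oriented_exists hp o0.
(* The turn at the topmost vertex, which is strictly extreme, determines the orientation. *)
have s0 : 0 < s.
  have := @extreme_turn _ _ _ hp s (0, 1) o4 os; rewrite S4.
  move=> /(_ _) h; suff : 0 < s * cross (edge adjacent_example o4) (edge adjacent_example o0).
    rewrite /edge S4 S0 /cross !coordE /=; lra.
  by apply: h; elim/ord5_ind => //= _; rewrite /dot /=; lra.
have [r0 r1 r2 r3 r4] := reflex_five_points hp os.
rewrite ?/adjacent_example ?/nonadjacent_example; apply/setP; elim/ord5_ind; rewrite ?r0 ?r1 ?r2 ?r3 ?r4 !inE -!val_eqE /orient /cross /=;
  [apply/negbTE | apply/negbTE | apply: (introT idP) | apply: (introT idP) | apply/negbTE]; rewrite -?leNgt; clear -s0; lra.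
Qed.

(** A triangle with one dent in its base, at height 1, and one in its right side, at height 4. *)
Definition nonadjacent_example : 'I_5 -> R * R :=
  five_points (- 6, 0) (0, 1) (6, 0) (2, 4) (0, 9).

Lemma nonadjacent_example_simple : simple_polygon nonadjacent_example.
Proof.
by apply: five_points_simple; split;
  first [apply/eqP => E | move=> s t hs ht E]; by_coordinates E.
Qed.

Lemma nonadjacent_example_reflex : reflex nonadjacent_example = [set o1; o3]%SET.
Proof.
have hp := nonadjacent_example_simple; have [S0 S1 S2 S3 S4] := ordS_o.
have [s os] := oriented_exists hp o0.
have s0 : 0 < s.
  have := @extreme_turn _ _ _ hp s (0, 1) o3 os; rewrite S3.
  move=> /(_ _) h; suff : 0 < s * cross (edge nonadjacent_example o3) (edge nonadjacent_example o4).
    rewrite /edge S3 S4 /cross !coordE /=; lra.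
  by apply: h; elim/ord5_ind => //= _; rewrite /dot /=; lra.
have [r0 r1 r2 r3 r4] := reflex_five_points hp os.
rewrite ?/adjacent_example ?/nonadjacent_example; apply/setP; elim/ord5_ind; rewrite ?r0 ?r1 ?r2 ?r3 ?r4 !inE -!val_eqE /orient /cross /=;
  [apply/negbTE | apply: (introT idP) | apply/negbTE | apply: (introT idP) | apply/negbTE]; rewrite -?leNgt; clear -s0; lra.
Qed.

End Examples.

Local Close Scope classical_set_scope.

Theorem proposition2p7 (R : realType) :
  (forall p : 'I_5 -> R * R, pentagon p -> ~ convex_polygon p ->
     (type1 p \/ type2 p) /\ ~ (type1 p /\ type2 p)) /\
  (exists (p : 'I_5 -> R * R) (i j : 'I_5),
     [/\ pentagon p, ~ convex_polygon p, type2 p,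
         reflex p = [set i; j]%SET & i != j /\ adjacent_vertices i j]) /\
  (exists (p : 'I_5 -> R * R) (i j : 'I_5),
     [/\ pentagon p, ~ convex_polygon p, type2 p,
         reflex p = [set i; j]%SET & i != j /\ ~ adjacent_vertices i j]) /\
  (forall p : 'I_5 -> R * R, pentagon p -> type1 p -> area p = 1%E ->
     4 < perimeter p) /\
  (forall p : 'I_5 -> R * R, pentagon p -> type2 p -> area p = 1%E ->
     3 * Num.sqrt (4 / Num.sqrt 3) < perimeter p).
Proof.
split=> [p hp ncv|]; first split; first exact: nonconvex_types.
  by rewrite /type1 /type2 => -[->] [].
split; [|split; [|split]].
- have [ncv t2] := two_reflex_type2 (@adjacent_example_simple R) (isT : o2 != o3) (@adjacent_example_reflex R).
  exists (@adjacent_example R), o2, o3; split => //; first exact: adjacent_example_simple.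
    exact: adjacent_example_reflex.
  by split=> //; left; apply: val_inj.
- have [ncv t2] := two_reflex_type2 (@nonadjacent_example_simple R) (isT : o1 != o3) (@nonadjacent_example_reflex R).
  exists (@nonadjacent_example R), o1, o3; split => //; first exact: nonadjacent_example_simple.
    exact: nonadjacent_example_reflex.
  by split=> // -[] /(congr1 val).
- by move=> p hp; exact: type1_perimeter.
- by move=> p hp; exact: type2_perimeter.
Qed.
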